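(* The isomorphism relation on $\operatorname{TFAb}_1$ is $\Sigma^0_3$, and every $\Sigma^0_3$ equivalence relation $E$ on a subspace of $2^\omega$ is computably countably reducible to the isomorphism relation on $\operatorname{TFAb}_1$. That is, there is a Turing functional which, given any sequence $(A_n)_{n\in\omega}$ of elements of the domain of $E$ (as the oracle $A_0\oplus A_1\oplus\cdots$), outputs a sequence $(G_n)_{n\in\omega}$ of groups in $\operatorname{TFAb}_1$ (as $G_0\oplus G_1\oplus\cdots$) such that for all $m<n$, $A_m\,E\,A_n$ if and only if $G_m\cong G_n$.
   Context: Groups in $\operatorname{TFAb}_1$ (torsion-free abelian groups of rank $1$) have universe $\omega$ and are given by their atomic diagrams in $2^\omega$. An equivalence relation $E$ on a subset of $2^\omega$ is $\Sigma^0_3$ if there is a computable predicate $R$ such that $A\,E\,B$ iff $\exists x\,\forall y\,\exists z\,R(A,B,x,y,z)$. *)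

(* Defs.v *)
From HB Require Import structures.
From Stdlib Require Cantor.
From mathcomp Require Import all_boot all_order all_algebra.

Set Implicit Arguments.
Unset Strict Implicit.
Unset Printing Implicit Defensive.

Import GRing.Theory.

Notation npair a b := (Cantor.to_nat (a, b)).

(* "Real" in the sense of computability theory: an element of 2^omega *)
Notation real := (nat -> bool).

Definition join (A B : real) : real :=
  fun k => if odd k then B k./2 else A k./2.

Definition bigjoin (A : nat -> real) : real :=
  fun k => let: (n, i) := Cantor.of_nat k in A n i.

(* Programs for Turing functionals: Kleene's mu-recursive functions relative
   to an oracle, presented as unary functions, with tuples coded by npair.  *)
Inductive code : Type :=
| Zero
| Succ
| Fst
| Snd
| Oracle
| Pair of code & code
| Comp of code & code
| PrimRec of code & code
| Mu of code.

(* eval X c x y: the program c with oracle X halts on input x with output y;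
   for Mu, the search is for the least y such that c outputs 0 on (x, y) and
   is defined and nonzero on (x, k) for every k < y.                        *)
Fixpoint eval (X : real) (c : code) (x y : nat) {struct c} : Prop :=
  match c with
  | Zero => y = 0
  | Succ => y = x.+1
  | Fst => y = (Cantor.of_nat x).1
  | Snd => y = (Cantor.of_nat x).2
  | Oracle => y = X x
  | Pair c d => exists a b, [/\ eval X c x a, eval X d x b & y = npair a b]
  | Comp c d => exists2 a, eval X d x a & eval X c a y
  | PrimRec c d =>
      let: (a, n) := Cantor.of_nat x in
      (fix rec (n y : nat) : Prop :=
         match n with
         | 0 => eval X c a y
         | m.+1 => exists2 w, rec m w & eval X d (npair a (npair m w)) y
         end) n y
  | Mu c =>
      eval X c (npair x y) 0 /\
      forall k, k < y -> exists w, eval X c (npair x k) w.+1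
  end.

Definition computes (c : code) (X Y : real) : Prop :=
  forall k, eval X c k (Y k).

Definition computable_predicate
    (P : real -> real -> nat -> nat -> nat -> bool) : Prop :=
  exists c : code, forall A B x y z,
    eval (join A B) c (npair x (npair y z)) (P A B x y z).

Definition equivalence_on (D : real -> Prop) (E : real -> real -> Prop) :
    Prop :=
  [/\ forall A, D A -> E A A,
      forall A B, D A -> D B -> E A B -> E B A
    & forall A B C, D A -> D B -> D C -> E A B -> E B C -> E A C].

Definition Sigma03_on (D : real -> Prop) (E : real -> real -> Prop) : Prop :=
  exists P : real -> real -> nat -> nat -> nat -> bool,
    computable_predicate P /\
    forall A B, D A -> D B ->
      (E A B <-> exists x, forall y, exists z, P A B x y z).

Definition computably_countably_reducible
    (D : real -> Prop) (E : real -> real -> Prop)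
    (D' : real -> Prop) (E' : real -> real -> Prop) : Prop :=
  exists c : code, forall A : nat -> real, (forall n, D (A n)) ->
    exists G : nat -> real,
      [/\ computes c (bigjoin A) (bigjoin G),
          forall n, D' (G n)
        & forall m n, m < n -> (E (A m) (A n) <-> E' (G m) (G n))].

Local Open Scope ring_scope.

Definition torsion_free (V : zmodType) : Prop :=
  forall (x : V) (n : nat), x *+ n = 0 -> n = 0%N \/ x = 0.

Definition Zindependent (V : zmodType) (n : nat) (v : 'I_n -> V) : Prop :=
  forall c : 'I_n -> int, \sum_(i < n) v i *~ c i = 0 -> forall i, c i = 0.

(* The largest size of a Z-linearly independent family is r *)
Definition has_rank (V : zmodType) (r : nat) : Prop :=
  (exists v : 'I_r -> V, Zindependent v) /\
  forall v : 'I_r.+1 -> V, ~ Zindependent v.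

(* An abelian group with universe omega is a Zmodule structure on nat,
   unrelated to the arithmetic of nat.                                     *)
Definition group_of (M : GRing.Zmodule nat) : zmodType :=
  GRing.Zmodule.Pack M.

(* Atomic sentences with parameters from omega in the language {+}, where, as
   usual in computable structure theory, + is treated as a ternary relation:
   a = b has number 2 <a, b>, and a + b = c has number 2 <a, <b, c>> + 1.  *)
Definition atomic_diagram (M : GRing.Zmodule nat) : real :=
  join
    (fun k => let: (a, b) := Cantor.of_nat k in (a : group_of M) == b)
    (fun k => let: (a, l) := Cantor.of_nat k in
              let: (b, c) := Cantor.of_nat l in (a : group_of M) + b == c).

Definition TFAb1 (G : real) : Prop :=
  exists M : GRing.Zmodule nat,
    [/\ G =1 atomic_diagram M,
        torsion_free (group_of M)
      & has_rank (group_of M) 1].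

Definition isomorphic (G H : real) : Prop :=
  exists M N : GRing.Zmodule nat,
    [/\ G =1 atomic_diagram M,
        H =1 atomic_diagram N
      & exists f : {additive group_of M -> group_of N}, bijective f].

(* Main.v *)
From HB Require Import structures.
From Stdlib Require Cantor.
From Stdlib Require Import ClassicalEpsilon.
From mathcomp Require Import all_boot all_order all_algebra.
From mathcomp Require Import zify ring.
Require Import Defs.

(* Baer: two torsion-free groups of rank 1 are isomorphic iff they contain
   nonzero elements with the same divisors, which is a Sigma^0_3 condition.

   For the hardness, write E(A_i, A_j) as "some edge <i, j, x> looks right up to
   every bound". The group G_j is the union of the (1 / d_s) Z for a computable
   divisibility chain (d_s), with one base out of a sequence of pairwise coprime
   numbers for each triple e = <m, n, x>. Let h be the least t for which m cannot
   be reached from n along edges below e that look right up to t. The height of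
   G_m at the base of e is h, the height of G_n is h + 1, and every other G_j
   has one of these two heights, according as j is reachable from n for h. If
   A_m and A_n are not equivalent then h is finite for all e = <m, n, x>, and the
   types of G_m and G_n differ infinitely often. If A_i and A_j are equivalent
   then they are mutually reachable for all t as soon as e is large, so G_i and
   G_j have the same height at all but finitely many bases, and heights differing
   by at most a finite amount at the others. *)

Set Implicit Arguments.
Unset Strict Implicit.
Unset Printing Implicit Defensive.

Import Order.TTheory GRing.Theory Num.Theory.

(** * Computable functions relative to an oracle *)

Notation p1 x := (Cantor.of_nat x).1.
Notation p2 x := (Cantor.of_nat x).2.

Lemma of_npair a b : Cantor.of_nat (npair a b) = (a, b).
Proof. exact: Cantor.cancel_of_to. Qed.

Lemma npair_of x : npair (p1 x) (p2 x) = x.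
Proof. by rewrite -surjective_pairing Cantor.cancel_to_of. Qed.

Lemma leq_npair a b : b + a <= npair a b.
Proof. by apply/ssrnat.leP; exact: Cantor.to_nat_non_decreasing. Qed.

(** Computability is uniform: one program serves every index [i], with [X i] as oracle. The indices
    will be sequences of reals for the reduction and pairs of reals for the isomorphism test. *)
Definition computable (I : Type) (X : I -> real) (f : I -> nat -> nat) :=
  exists c, forall i k, eval (X i) c k (f i k).

Section Computable.
Variables (I : Type) (X : I -> real).
Implicit Types (f g h : I -> nat -> nat) (b : I -> nat -> bool).

Lemma computable_ext f g :
  (forall i x, f i x = g i x) -> computable X f -> computable X g.
Proof. by move=> fg [c hc]; exists c => i k; rewrite -fg. Qed.

Lemma computable_id : computable X (fun _ x => x).
Proof.
by exists (Pair Fst Snd) => i k; exists (p1 k), (p2 k); rewrite npair_of.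
Qed.

Lemma computable_comp f g :
  computable X f -> computable X g -> computable X (fun i x => f i (g i x)).
Proof. by move=> [c hc] [d hd]; exists (Comp c d) => i k; exists (g i k). Qed.

Lemma computable_succ f : computable X f -> computable X (fun i x => (f i x).+1).
Proof. by move=> [c hc]; exists (Comp Succ c) => i k; exists (f i k). Qed.

Lemma computable_const n : computable X (fun _ _ => n).
Proof. by elim: n => [|n]; [exists Zero | exact: computable_succ]. Qed.

Lemma computable_p1 f : computable X f -> computable X (fun i x => p1 (f i x)).
Proof. by move=> [c hc]; exists (Comp Fst c) => i k; exists (f i k). Qed.

Lemma computable_p2 f : computable X f -> computable X (fun i x => p2 (f i x)).
Proof. by move=> [c hc]; exists (Comp Snd c) => i k; exists (f i k). Qed.

Lemma computable_npair f g : computable X f -> computable X g ->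
  computable X (fun i x => npair (f i x) (g i x)).
Proof.
by move=> [c hc] [d hd]; exists (Pair c d) => i k; exists (f i k), (g i k).
Qed.

Lemma computable_oracle f : computable X f ->
  computable X (fun i x => nat_of_bool (X i (f i x))).
Proof. by move=> [c hc]; exists (Comp Oracle c) => i k; exists (f i k). Qed.

Lemma computable_rec f g (h : I -> nat -> nat -> nat -> nat) :
  computable X f -> computable X g ->
  computable X (fun i u => h i (p1 u) (p1 (p2 u)) (p2 (p2 u))) ->
  computable X (fun i x => nat_rec (fun _ => nat) (f i x) (h i x) (g i x)).
Proof.
move=> [c hc] [d hd] [s hs].
(* [Pair Fst Snd] is the identity: the whole input is the parameter of the recursion, so the step
   may use it. *)
exists (Comp (PrimRec c s) (Pair (Pair Fst Snd) d)) => i k.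
exists (npair k (g i k)).
  exists k, (g i k); split=> //.
  by exists (p1 k), (p2 k); rewrite npair_of.
rewrite /= ?of_npair; elim: (g i k) => [|m IHm] /=; first exact: hc.
exists (nat_rec (fun _ => nat) (f i k) (h i k) m); first exact: IHm.
by have := hs i (npair k (npair m (nat_rec (fun _ => nat) (f i k) (h i k) m)));
   rewrite !of_npair /= ?of_npair.
Qed.

(** [Mu] searches for the least zero of a program, so the test is negated; [b i x (f i x)] makes the
    search halt, and minimality makes it halt at [f i x]. *)
Lemma computable_mu f (b : I -> nat -> nat -> bool) :
  computable X (fun i u => nat_of_bool (~~ b i (p1 u) (p2 u))) ->
  (forall i x, b i x (f i x)) -> (forall i x k, b i x k -> f i x <= k) ->
  computable X f.
Proof.
move=> [c hc] bf minf; exists (Mu c) => i x; split.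
  by have := hc i (npair x (f i x)); rewrite of_npair /= bf.
move=> k lt_k; exists 0.
have := hc i (npair x k); rewrite of_npair /=.
by case: (boolP (b i x k)) => [/minf|//]; rewrite leqNgt lt_k.
Qed.

Lemma computable_add f g : computable X f -> computable X g ->
  computable X (fun i x => f i x + g i x).
Proof.
move=> hf hg.
apply: (computable_ext (f := fun i x =>
  nat_rec (fun _ => nat) (f i x) (fun _ w => w.+1) (g i x))).
  by move=> i x; elim: (g i x) => [|n IHn]; rewrite ?addn0 // addnS -IHn.
apply: computable_rec => //.
by apply/computable_succ/computable_p2/computable_p2/computable_id.
Qed.

Lemma computable_mul f g : computable X f -> computable X g ->
  computable X (fun i x => f i x * g i x).
Proof.
move=> hf hg.
apply: (computable_ext (f := fun i x =>
  nat_rec (fun _ => nat) 0 (fun _ w => w + f i x) (g i x))).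
  by move=> i x; elim: (g i x) => [|n IHn]; rewrite ?muln0 // mulnSr -IHn.
apply: (@computable_rec _ _ (fun i x _ w => w + f i x)) => //.
  exact: computable_const.
apply: computable_add; first by apply/computable_p2/computable_p2/computable_id.
by apply: computable_comp => //; apply/computable_p1/computable_id.
Qed.

Lemma computable_pred f : computable X f -> computable X (fun i x => (f i x).-1).
Proof.
move=> hf.
apply: (computable_ext (f := fun i x =>
  nat_rec (fun _ => nat) 0 (fun m _ => m) (f i x))).
  by move=> i x; case: (f i x).
apply: computable_rec => //; first exact: computable_const.
by apply/computable_p1/computable_p2/computable_id.
Qed.

Lemma computable_sub f g : computable X f -> computable X g ->
  computable X (fun i x => f i x - g i x).
Proof.
move=> hf hg.
apply: (computable_ext (f := fun i x =>
  nat_rec (fun _ => nat) (f i x) (fun _ w => w.-1) (g i x))).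
  by move=> i x; elim: (g i x) => [|n IHn]; rewrite ?subn0 // subnS -IHn.
apply: computable_rec => //.
by apply/computable_pred/computable_p2/computable_p2/computable_id.
Qed.

Lemma computable_exp f g : computable X f -> computable X g ->
  computable X (fun i x => f i x ^ g i x).
Proof.
move=> hf hg.
apply: (computable_ext (f := fun i x =>
  nat_rec (fun _ => nat) 1 (fun _ w => w * f i x) (g i x))).
  by move=> i x; elim: (g i x) => [|n IHn] //; rewrite expnSr -IHn.
apply: (@computable_rec _ _ (fun i x _ w => w * f i x)) => //.
  exact: computable_const.
apply: computable_mul; first by apply/computable_p2/computable_p2/computable_id.
by apply: computable_comp => //; apply/computable_p1/computable_id.
Qed.

Lemma computable_negb b : computable X (fun i x => nat_of_bool (b i x)) ->
  computable X (fun i x => nat_of_bool (~~ b i x)).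
Proof.
move=> hb; apply: computable_ext (computable_sub (computable_const 1) hb).
by move=> i x; case: (b i x).
Qed.

Lemma computable_eq0 f : computable X f ->
  computable X (fun i x => nat_of_bool (f i x == 0)).
Proof.
move=> hf; apply: computable_ext (computable_sub (computable_const 1) hf).
by move=> i x; case: (f i x) => // n; rewrite subSS sub0n.
Qed.

Lemma computable_eq f g : computable X f -> computable X g ->
  computable X (fun i x => nat_of_bool (f i x == g i x)).
Proof.
move=> hf hg; apply: (computable_ext (f := fun i x =>
  nat_of_bool ((f i x - g i x) + (g i x - f i x) == 0))).
  by move=> i x; rewrite addn_eq0 !subn_eq0 eqn_leq.
by apply: computable_eq0; apply: computable_add; apply: computable_sub.
Qed.

Lemma computable_ltn f g : computable X f -> computable X g ->
  computable X (fun i x => nat_of_bool (f i x < g i x)).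
Proof.
move=> hf hg; apply: computable_ext
  (computable_eq0 (computable_sub (computable_succ hf) hg)).
by move=> i x; rewrite subn_eq0.
Qed.

Lemma computable_and b b' : computable X (fun i x => nat_of_bool (b i x)) ->
  computable X (fun i x => nat_of_bool (b' i x)) ->
  computable X (fun i x => nat_of_bool (b i x && b' i x)).
Proof.
move=> hb hb'; apply: computable_ext (computable_mul hb hb').
by move=> i x; rewrite mulnb.
Qed.

Lemma computable_or b b' : computable X (fun i x => nat_of_bool (b i x)) ->
  computable X (fun i x => nat_of_bool (b' i x)) ->
  computable X (fun i x => nat_of_bool (b i x || b' i x)).
Proof.
move=> hb hb'; apply: computable_ext
  (computable_negb (computable_and (computable_negb hb) (computable_negb hb'))).
by move=> i x; case: (b i x) (b' i x) => [] [].
Qed.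

Lemma computable_imp b b' : computable X (fun i x => nat_of_bool (b i x)) ->
  computable X (fun i x => nat_of_bool (b' i x)) ->
  computable X (fun i x => nat_of_bool (b i x ==> b' i x)).
Proof.
move=> hb hb'; apply: computable_ext (computable_or (computable_negb hb) hb').
by move=> i x; rewrite implybE.
Qed.

Lemma computable_if b f g : computable X (fun i x => nat_of_bool (b i x)) ->
  computable X f -> computable X g ->
  computable X (fun i x => if b i x then f i x else g i x).
Proof.
move=> hb hf hg; apply: computable_ext (computable_add (computable_mul hb hf)
  (computable_mul (computable_negb hb) hg)).
by move=> i x; case: (b i x); rewrite ?mul1n ?addn0.
Qed.

Lemma computable_odd f : computable X f ->
  computable X (fun i x => nat_of_bool (odd (f i x))).
Proof.
move=> hf; apply: (computable_ext (f := fun i x =>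
  nat_rec (fun _ => nat) 0 (fun _ w => 1 - w) (f i x))).
  by move=> i x; elim: (f i x) => //= n ->; case: (odd n).
apply: computable_rec => //; first exact: computable_const.
apply: computable_sub; first exact: computable_const.
by apply/computable_p2/computable_p2/computable_id.
Qed.

Lemma computable_half f : computable X f ->
  computable X (fun i x => (f i x)./2).
Proof.
move=> hf; apply: (computable_ext (f := fun i x =>
  nat_rec (fun _ => nat) 0 (fun m w => odd m + w) (f i x))).
  by move=> i x; elim: (f i x) => //= n ->; rewrite uphalf_half.
apply: computable_rec => //; first exact: computable_const.
apply: computable_add; last by apply/computable_p2/computable_p2/computable_id.
by apply/computable_odd/computable_p1/computable_p2/computable_id.
Qed.

Lemma computable_double f : computable X f ->
  computable X (fun i x => (f i x).*2).
Proof.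
move=> hf; apply: computable_ext (computable_mul (computable_const 2) hf).
by move=> i x; rewrite mul2n.
Qed.

Lemma computable_iter f g (h : I -> nat -> nat) :
  computable X f -> computable X g -> computable X h ->
  computable X (fun i x => iter (g i x) (h i) (f i x)).
Proof.
move=> hf hg hh; apply: (computable_ext (f := fun i x =>
  nat_rec (fun _ => nat) (f i x) (fun _ w => h i w) (g i x))).
  by move=> i x; elim: (g i x) => //= n ->.
apply: (@computable_rec _ _ (fun i x _ w => h i w)) => //.
by apply: computable_comp => //; apply/computable_p2/computable_p2/computable_id.
Qed.

(** A recursion step receives [<x, <m, w>>]; this drops the accumulator [w], so that a term given as
    a function of [<x, m>] can be summed or multiplied up. *)
Lemma computable_rec_step (h : I -> nat -> nat -> nat) :
  computable X (fun i u => h i (p1 u) (p2 u)) ->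
  computable X (fun i u => h i (p1 u) (p1 (p2 u))).
Proof.
move=> hh.
apply: (computable_ext (f := fun i u => h i (p1 (npair (p1 u) (p1 (p2 u))))
   (p2 (npair (p1 u) (p1 (p2 u)))))).
  by move=> i u; rewrite of_npair.
apply: (computable_comp (f := fun i u => h i (p1 u) (p2 u))) => //.
apply: computable_npair; first by apply/computable_p1/computable_id.
by apply/computable_p1/computable_p2/computable_id.
Qed.

Lemma computable_sum g (h : I -> nat -> nat -> nat) :
  computable X g -> computable X (fun i u => h i (p1 u) (p2 u)) ->
  computable X (fun i x => \sum_(k < g i x) h i x k).
Proof.
move=> hg /computable_rec_step hh; apply: (computable_ext (f := fun i x =>
  nat_rec (fun _ => nat) 0 (fun m w => w + h i x m) (g i x))).
  move=> i x; elim: (g i x) => [|n IHn] /=; first by rewrite big_ord0.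
  by rewrite big_ord_recr /= IHn.
apply: (@computable_rec _ _ (fun i x m w => w + h i x m)) => //.
  exact: computable_const.
by apply: computable_add => //; apply/computable_p2/computable_p2/computable_id.
Qed.

Lemma computable_prod g (h : I -> nat -> nat -> nat) :
  computable X g -> computable X (fun i u => h i (p1 u) (p2 u)) ->
  computable X (fun i x => \prod_(k < g i x) h i x k).
Proof.
move=> hg /computable_rec_step hh; apply: (computable_ext (f := fun i x =>
  nat_rec (fun _ => nat) 1 (fun m w => w * h i x m) (g i x))).
  move=> i x; elim: (g i x) => [|n IHn] /=; first by rewrite big_ord0.
  by rewrite big_ord_recr /= IHn.
apply: (@computable_rec _ _ (fun i x m w => w * h i x m)) => //.
  exact: computable_const.
by apply: computable_mul => //; apply/computable_p2/computable_p2/computable_id.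
Qed.

End Computable.

(** * Bounded quantifiers *)

Definition ball n (P : pred nat) := all P (iota 0 n).
Definition bex n (P : pred nat) := has P (iota 0 n).

Lemma ballP n (P : pred nat) :
  reflect (forall k, k < n -> P k) (ball n P).
Proof.
apply: (iffP allP) => h k; last by rewrite mem_iota => /h.
by move=> lt_kn; apply: h; rewrite mem_iota.
Qed.

Lemma bexP n (P : pred nat) :
  reflect (exists2 k, k < n & P k) (bex n P).
Proof.
apply: (iffP hasP) => -[k kn Pk]; exists k => //; first by rewrite mem_iota in kn.
by rewrite mem_iota.
Qed.

Lemma computable_ball (I : Type) (X : I -> real) g (h : I -> nat -> nat -> bool) :
  computable X g -> computable X (fun i u => nat_of_bool (h i (p1 u) (p2 u))) ->
  computable X (fun i x => nat_of_bool (ball (g i x) (h i x))).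
Proof.
move=> hg hh.
have hp := computable_prod (h := fun i x k => nat_of_bool (h i x k)) hg hh.
apply: computable_ext hp => i x.
elim: (g i x) => [|n IHn]; first by rewrite big_ord0.
by rewrite big_ord_recr /= IHn mulnb /ball -[n.+1]addn1 iotaD all_cat /= andbT.
Qed.

Lemma computable_bex (I : Type) (X : I -> real) g (h : I -> nat -> nat -> bool) :
  computable X g -> computable X (fun i u => nat_of_bool (h i (p1 u) (p2 u))) ->
  computable X (fun i x => nat_of_bool (bex (g i x) (h i x))).
Proof.
move=> hg hh; have hn := computable_negb (computable_ball
  (h := fun i x k => ~~ h i x k) hg (computable_negb hh)).
apply: computable_ext hn => i x.
by rewrite /ball /bex all_predC negbK.
Qed.

Ltac computable_step :=
  first [ assumption
        | apply: computable_id | apply: computable_const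
        | apply: computable_p1 | apply: computable_p2
        | apply: computable_npair
        | apply: computable_and | apply: computable_or | apply: computable_imp
        | apply: computable_negb | apply: computable_eq | apply: computable_ltn
        | apply: computable_odd
        | apply: computable_half | apply: computable_double | apply: computable_pred
        | apply: computable_succ | apply: computable_add
        | apply: computable_mul | apply: computable_sub
        | apply: computable_exp
        | apply: computable_ball | apply: computable_bex
        | (* last, since [nat_of_bool] is also an [if] *)
          apply: computable_if ].

Ltac computable_tac := repeat (computable_step; cbv beta).

(** The new program carries [<m, n>] along with its input and sends each query to [A m] or [A n] to
    the right column of the big join. Thus a single program treats all pairs of members of a
    sequence. Induction on [c]: each construct must hand the pair on to its subprograms. *)
Lemma oracle_substitution c : exists c', forall (A : nat -> real) m n x y,
  eval (join (A m) (A n)) c x y ->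
  eval (bigjoin A) c' (npair (npair m n) x) y.
Proof.
have comp1 (f : nat -> nat) : computable bigjoin (fun _ => f) ->
    exists c, forall A x, eval (bigjoin A) c x (f x) by [].
elim: c => [||||| c [c' hc] d [d' hd] | c [c' hc] d [d' hd]
  | c [c' hc] d [d' hd] | c [c' hc]].
- by exists Zero.
- by exists (Comp Succ Snd) => A m n x y ->; exists x => //=; rewrite of_npair.
- by exists (Comp Fst Snd) => A m n x y ->; exists x => //=; rewrite of_npair.
- by exists (Comp Snd Snd) => A m n x y ->; exists x => //=; rewrite of_npair.
- have [c hc] : computable bigjoin (fun A u => nat_of_bool (bigjoin A
      (npair (if odd (p2 u) then p2 (p1 u) else p1 (p1 u)) (p2 u)./2))).
    by apply: computable_oracle; computable_tac.
  exists c => A m n x y ->.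
  have := hc A (npair (npair m n) x); rewrite !of_npair /= ?of_npair /=.
  by rewrite /bigjoin of_npair /join; case: (odd x).
- exists (Pair c' d') => A m n x y /= [a [b [ha hb ->]]].
  by exists a, b; split; [exact: hc | exact: hd | ].
- exists (Comp c' (Pair Fst d')) => A m n x y /= [a ha hb].
  exists (npair (npair m n) a); last exact: hc.
  by exists (npair m n), a; split; rewrite ?of_npair //; exact: hd.
(* [r] turns [<q, <a, k>>] into [<<q, a>, k>], which makes [q] a part of the parameter of the
   recursion; [r'] moves it back out for the step. *)
- have [r hr] : computable bigjoin (fun _ u =>
      npair (npair (p1 u) (p1 (p2 u))) (p2 (p2 u))).
    by computable_tac.
  have [r' hr'] : computable bigjoin (fun _ u =>
      npair (p1 (p1 u)) (npair (p2 (p1 u)) (p2 u))).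
    by computable_tac.
  exists (Comp (PrimRec c' (Comp d' r')) r) => A m n x y /=.
  set q := npair m n.
  case: (Cantor.of_nat x) (npair_of x) => a k /= def_x hx.
  exists (npair (npair q a) k).
    by have := hr A (npair q x); rewrite of_npair /= -def_x ?of_npair.
  rewrite of_npair; elim: k y hx {def_x} => [|k IHk] y /=; first exact: hc.
  move=> [w hw hy]; exists w; first exact: IHk.
  exists (npair q (npair a (npair k w))); last exact: hd.
  by have := hr' A (npair (npair q a) (npair k w)); rewrite of_npair /= ?of_npair.
- have [r hr] : computable bigjoin (fun _ u =>
      npair (p1 (p1 u)) (npair (p2 (p1 u)) (p2 u))).
    by computable_tac.
  have hr2 A q x k : eval (bigjoin A) r (npair (npair q x) k)
      (npair q (npair x k)).
    by have := hr A (npair (npair q x) k); rewrite of_npair /= ?of_npair.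
  exists (Mu (Comp c' r)) => A m n x y /= [h0 hk]; split.
    by exists (npair (npair m n) (npair x y)); [exact: hr2 | exact: hc].
  move=> k /hk[w hw]; exists w.
  by exists (npair (npair m n) (npair x k)); [exact: hr2 | exact: hc].
Qed.

(** * Groups of rank 1 *)

Section RankOne.
Local Open Scope ring_scope.

Lemma torsion_free_mulrz (U : zmodType) (x : U) (k : int) :
  torsion_free U -> x *~ k = 0 -> k = 0 \/ x = 0.
Proof.
move=> tf; case: k => n; first by move=> /(tf x) [->|]; auto.
by rewrite NegzE mulrNz => /eqP; rewrite oppr_eq0 => /eqP/(tf x)[//|]; auto.
Qed.

Lemma torsion_free_mulrn_inj (U : zmodType) (x y : U) (n : nat) :
  torsion_free U -> (0 < n)%N -> x *+ n = y *+ n -> x = y.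
Proof.
move=> tf n_gt0 /eqP; rewrite -subr_eq0 -mulrnBl => /eqP/(tf _)[n0|/eqP].
  by rewrite n0 in n_gt0.
by rewrite subr_eq0 => /eqP.
Qed.

(** A nontrivial relation between [x] and [a] has a nonzero coefficient at [x], since otherwise [a]
    would be torsion. The common factor of the coefficients cancels in a torsion-free group;
    coprimality is what allows a Bezout argument later. *)
Lemma rank_one_proportional (U : zmodType) (a x : U) :
  torsion_free U -> (forall v : 'I_2 -> U, ~ Zindependent v) -> a != 0 ->
  exists n k, [/\ (0 < n)%N, coprime n `|k|%N & x *+ n = a *~ k].
Proof.
move=> tf rk1 /eqP aN0.
have [n [k [n_gt0 E]]] : exists n k, (0 < n)%N /\ x *+ n = a *~ k.
  apply: NNPP => no.
  apply: (rk1 (fun i => if i == ord0 then x else a)) => c.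
  rewrite big_ord_recl big_ord1 /= => E.
  have [c0|c0N] := eqVneq (c ord0) 0.
    move: E; rewrite c0 mulr0z add0r => /(torsion_free_mulrz tf)[c1|//] i.
    case: (unliftP ord0 i) => [j ->|-> //].
    by rewrite ord1.
  (* The sign of the coefficient of [x] is moved to the other side to make [n] a positive natural
     number. *)
  case: no; exists `|c ord0|%N, (- Num.sg (c ord0) * c (lift ord0 ord0)).
  split; first by rewrite absz_gt0.
  move/eqP: E; rewrite addr_eq0 => /eqP E.
  rewrite pmulrn abszE normrEsg mulrC mulrzA E.
  by rewrite mulrC mulrzA mulrNz mulNrz.
set g := gcdn n `|k|%N.
have g_gt0 : (0 < g)%N by rewrite gcdn_gt0 n_gt0.
have [n' def_n] : exists n', (n = n' * g)%N by apply/dvdnP; apply: dvdn_gcdl.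
have [k' def_k] : exists k', k = k' * g%:Z.
  by apply/dvdzP; rewrite dvdzE /= dvdn_gcdr.
exists n', k'; split.
- by move: n_gt0; rewrite def_n muln_gt0 => /andP[].
- have : (gcdn n' `|k'| * g == 1 * g)%N.
    by rewrite mul1n {2}/g muln_gcdl def_k abszM absz_nat -def_n.
  by rewrite eqn_pmul2r.
- apply: (torsion_free_mulrn_inj tf g_gt0).
  by rewrite -mulrnA -def_n E def_k mulrzA pmulrn.
Qed.

Section SameType.
Variables (U V : zmodType) (a : U) (b : V).
Hypotheses (tfU : torsion_free U) (tfV : torsion_free V).
Hypothesis rkU : forall v : 'I_2 -> U, ~ Zindependent v.
Hypotheses (aN0 : a != 0) (bN0 : b != 0).
Hypothesis divab : forall n, (0 < n)%N ->
  (exists c, c *+ n = a) -> exists d, d *+ n = b.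

(** Let [n x = k a] with [u n + v k = 1]. Then [c = u a + v x] satisfies [n c = a], so [n] divides
    [a], hence [b = n d] for some [d], and [k d] is the image wanted for [x]. *)
Lemma same_type_total x : exists t : nat * int * V,
  [&& (0 < t.1.1)%N, x *+ t.1.1 == a *~ t.1.2 & t.2 *+ t.1.1 == b *~ t.1.2].
Proof.
have [n [k [n_gt0 co_nk E]]] := rank_one_proportional x tfU rkU aN0.
have [[u v] bez] : exists uv : int * int, uv.1 * n + uv.2 * k = 1.
  have [u [v H]] := Bezoutz n k; exists (u, v) => /=.
  by rewrite H /gcdz /=; move/eqP: co_nk => ->.
have [d Ed] : exists d, d *+ n = b.
  apply: divab => //; exists (a *~ u + x *~ v).
  rewrite mulrnDl !pmulrn -!mulrzA [v * _]mulrC (mulrzA x) -(pmulrn x) E -mulrzA.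
  by rewrite -mulrzDr [k * v]mulrC bez.
exists (n, k, d *~ k) => /=.
by rewrite n_gt0 E eqxx -Ed !pmulrn -!mulrzA mulrC eqxx.
Qed.

Definition same_type_map x := (xchoose (same_type_total x)).2.

(** The image does not depend on the chosen relation: if also [m x = l a], then [l n = k m] because
    [a] has infinite order, and torsion-freeness allows cancelling [m]. *)
Lemma same_type_mapE x (n : nat) (k : int) :
  x *+ n = a *~ k -> same_type_map x *+ n = b *~ k.
Proof.
move=> E; rewrite /same_type_map; move: (xchooseP (same_type_total x)).
case: (xchoose _) => [[m l] y] /= /and3P[m_gt0 /eqP Ex /eqP Ey].
have El : l * n = k * m.
  have : a *~ (l * n - k * m) = 0.
    rewrite mulrzBr !mulrzA -Ex -E -!pmulrn -!mulrnA mulnC subrr //.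
  case/(torsion_free_mulrz tfU) => [/eqP|/eqP a0].
    by rewrite subr_eq0 => /eqP.
  by have := aN0; rewrite a0.
apply: (torsion_free_mulrn_inj tfV m_gt0).
by rewrite -mulrnA mulnC mulrnA Ey !pmulrn -!mulrzA El.
Qed.

End SameType.

(** A relation [n x = k a] is carried to [b] by one map and back to [a] by the other, and it
    determines [x]. *)
Lemma same_type_mapK (U V : zmodType) (a : U) (b : V)
  (tfU : torsion_free U) (tfV : torsion_free V)
  (rkU : forall v : 'I_2 -> U, ~ Zindependent v)
  (rkV : forall v : 'I_2 -> V, ~ Zindependent v)
  (aN0 : a != 0) (bN0 : b != 0)
  (dab : forall n, (0 < n)%N -> (exists c, c *+ n = a) -> exists d, d *+ n = b)
  (dba : forall n, (0 < n)%N -> (exists d, d *+ n = b) -> exists c, c *+ n = a) :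
  cancel (same_type_map tfU rkU aN0 dab) (same_type_map tfV rkV bN0 dba).
Proof.
move=> x; have [n [k [n_gt0 _ E]]] := rank_one_proportional x tfU rkU aN0.
apply: (torsion_free_mulrn_inj tfU n_gt0).
rewrite E; apply: same_type_mapE => //.
exact: same_type_mapE.
Qed.

Lemma same_type_map_additive (U V : zmodType) (a : U) (b : V)
  (tfU : torsion_free U) (tfV : torsion_free V)
  (rkU : forall v : 'I_2 -> U, ~ Zindependent v)
  (aN0 : a != 0)
  (dab : forall n, (0 < n)%N -> (exists c, c *+ n = a) -> exists d, d *+ n = b) x y :
  same_type_map tfU rkU aN0 dab (x + y) =
  same_type_map tfU rkU aN0 dab x + same_type_map tfU rkU aN0 dab y.
Proof.
have [n [k [n_gt0 _ Ex]]] := rank_one_proportional x tfU rkU aN0.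
have [m [l [m_gt0 _ Ey]]] := rank_one_proportional y tfU rkU aN0.
apply: (@torsion_free_mulrn_inj _ _ _ (n * m)%N tfV).
  by rewrite muln_gt0 n_gt0.
have E z p r q : z *+ p = a *~ r ->
    z *+ (p * q) = a *~ (r * q) by rewrite mulrnA mulrzA -pmulrn => ->.
have F z p r : z *+ p = a *~ r -> same_type_map tfU rkU aN0 dab z *+ p = b *~ r.
  exact: same_type_mapE.
have Ex' := E _ _ _ m Ex; have Ey' := E _ _ _ n Ey.
rewrite [(m * n)%N]mulnC in Ey'.
rewrite mulrnDl (F _ _ _ Ex') (F _ _ _ Ey') -mulrzDr; apply: F.
by rewrite mulrnDl Ex' Ey' mulrzDr.
Qed.

End RankOne.

(** * Groups with universe omega and Baer's criterion *)

Notation gadd M a b := (@GRing.add (group_of M) a b).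

Section Diagrams.
Local Open Scope ring_scope.

Lemma additive_of_fun (U V : zmodType) (f : U -> V) :
  (forall x y, f (x + y) = f x + f y) -> exists g : {additive U -> V}, g =1 f.
Proof.
move=> fD; have fB : zmod_morphism f.
  by move=> x y; apply: (addIr (f y)); rewrite -fD !subrK.
pose F := GRing.isZmodMorphism.Build U V f fB.
by exists (HB.pack_for {additive U -> V} f F).
Qed.

(* [nat] already carries a canonical additive structure, which would get in the
   way of another one. *)
Definition universe : Type := nat.
HB.instance Definition _ := Choice.copy universe nat.

(** The range of [v] is a subgroup of the rationals; its structure is pulled back to the universe,
    and injectivity of [v] transfers the axioms. *)
Lemma zmodule_of_injection (v : nat -> rat) :
  injective v -> (exists a, v a == 0) ->
  (forall a b, exists c, v c == v a + v b) -> (forall a, exists b, v b == - v a) ->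
  exists M : GRing.Zmodule nat, forall a b, v (gadd M a b) = v a + v b.
Proof.
move=> v_inj v0 vD vN.
pose zero : universe := xchoose v0.
pose opp (a : universe) : universe := xchoose (vN a).
pose add (a b : universe) : universe := xchoose (vD a b).
have Ezero : v zero = 0 by apply/eqP; exact: (xchooseP v0).
have Eadd a b : v (add a b) = v a + v b by apply/eqP; exact: (xchooseP (vD a b)).
have Eopp a : v (opp a) = - v a by apply/eqP; exact: (xchooseP (vN a)).
have addA : associative add by move=> a b c; apply: v_inj; rewrite !Eadd addrA.
have addC : commutative add by move=> a b; apply: v_inj; rewrite !Eadd addrC.
have add0 : left_id zero add by move=> a; apply: v_inj; rewrite Eadd Ezero add0r.
have addN : left_inverse zero opp add.
  by move=> a; apply: v_inj; rewrite Eadd Ezero Eopp addNr.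
pose F := GRing.isZmodule.Build universe addA addC add0 addN.
pose U : zmodType := HB.pack_for zmodType universe F.
by exists (GRing.Zmodule.class U) => a b; exact: Eadd.
Qed.

(** For nonzero elements of torsion-free groups this says that their height sequences agree. *)
Definition same_divisors (U V : zmodType) (a : U) (b : V) :=
  forall n, (0 < n)%N -> (exists c, c *+ n = a) <-> (exists d, d *+ n = b).

Lemma diagram_add (G : real) (M : GRing.Zmodule nat) a b c :
  G =1 atomic_diagram M ->
  G (npair a (npair b c)).*2.+1 = (gadd M a b == c).
Proof.
move=> ->; rewrite /atomic_diagram /join /= odd_double /= uphalf_double.
by rewrite !of_npair.
Qed.

(** [isomorphic] supplies group structures of its own; this compares them with given ones that have
    the same diagram. *)
Lemma diagram_add_inj (G : real) (M N : GRing.Zmodule nat) :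
  G =1 atomic_diagram M -> G =1 atomic_diagram N ->
  forall a b, gadd M a b = gadd N a b.
Proof.
move=> GM GN a b.
have := diagram_add a b (gadd M a b) GM.
by rewrite (diagram_add _ _ _ GN) [RHS]eqxx => /eqP.
Qed.

(** Zero is not a symbol of the language, but it is the only solution of [a + a = a]. *)
Lemma diagram_neq0 (G : real) (M : GRing.Zmodule nat) (a : group_of M) :
  G =1 atomic_diagram M -> (a != 0) = ~~ G (npair a (npair a a)).*2.+1.
Proof.
by move=> GM; rewrite (diagram_add a a a GM) -[in RHS]subr_eq0 addrK.
Qed.

Lemma rank_one_neq0 (U : zmodType) : has_rank U 1 -> exists a : U, a != 0.
Proof.
move=> [[v vind] _]; exists (v ord0); apply/eqP => v0.
by have := vind (fun=> 1); rewrite big_ord1 v0 mul0rz => /(_ erefl ord0).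
Qed.

(** Baer's theorem. An isomorphism preserves the divisors of any nonzero element; conversely, the
    maps built from [a] and [b] in both directions are mutually inverse. *)
Lemma isomorphicP (G H : real) (M N : GRing.Zmodule nat) :
  G =1 atomic_diagram M -> H =1 atomic_diagram N ->
  torsion_free (group_of M) -> torsion_free (group_of N) ->
  has_rank (group_of M) 1 -> has_rank (group_of N) 1 ->
  isomorphic G H <->
  exists (a : group_of M) (b : group_of N),
    [/\ a != 0, b != 0 & same_divisors a b].
Proof.
move=> GM HN tfM tfN rkM rkN; split.
  move=> [M' [N' [GM' HN' [f f_bij]]]].
  (* [f] is additive for the structures [M'] and [N']; it is repackaged as a morphism for [M] and
     [N], which have the same additions. *)
  have [|g gf] := @additive_of_fun (group_of M) (group_of N) (fun x => f x).
    move=> x y; rewrite (diagram_add_inj GM GM').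
    by rewrite (diagram_add_inj HN HN') raddfD.
  have g_bij : bijective g.
    by apply: (eq_bij (f := f)) => // x; rewrite gf.
  have [h gK hK] := g_bij.
  have [a aN0] := rank_one_neq0 rkM.
  exists a, (g a); split=> //.
    by rewrite -(raddf0 g) (inj_eq (can_inj gK)).
  move=> n n_gt0; split=> [[c <-]|[d Ed]]; first by exists (g c); rewrite raddfMn.
  exists (h d); apply: (can_inj gK).
  by rewrite raddfMn hK.
move=> [a [b [aN0 bN0 ab]]].
pose dab n (hn : (0 < n)%N) := proj1 (ab n hn).
pose dba n (hn : (0 < n)%N) := proj2 (ab n hn).
have [g Eg] := additive_of_fun
  (same_type_map_additive tfM tfN rkM.2 aN0 dab).
exists M, N; split=> //; exists g.
exists (same_type_map tfN rkN.2 bN0 dba) => x; rewrite Eg.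
  exact: same_type_mapK.
exact: (same_type_mapK tfN tfM rkN.2 rkM.2 bN0 aN0 dba dab).
Qed.

Lemma embedded_rank_one (M : GRing.Zmodule nat) (v : nat -> rat) :
  injective v -> (forall a b, v (gadd M a b) = v a + v b) ->
  (exists a, v a != 0) ->
  torsion_free (group_of M) /\ has_rank (group_of M) 1.
Proof.
move=> v_inj vD [a0 va0].
have [f Ef] := @additive_of_fun (group_of M) rat v vD.
have f_inj : injective f by move=> x y; rewrite !Ef => /v_inj.
have fz (x : group_of M) k : f (x *~ k) = f x * k%:~R by rewrite raddfMz mulrzr.
split.
  move=> x n xn0; have : f x * n%:R = 0 by rewrite mulr_natr -raddfMn xn0 raddf0.
  move/eqP; rewrite mulf_eq0 pnatr_eq0 => /orP[/eqP fx0|/eqP]; last by left.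
  by right; apply: f_inj; rewrite fx0 raddf0.
split.
  exists (fun=> a0 : group_of M) => c; rewrite big_ord1 => E i; rewrite ord1.
  have : f a0 * (c ord0)%:~R = 0 by rewrite -fz E raddf0.
  by move/eqP; rewrite mulf_eq0 Ef (negPf va0) intr_eq0 => /eqP.
move=> w wind.
pose x := f (w ord0); pose y := f (w (lift ord0 ord0)).
have E0 (k l : int) : x * k%:~R + y * l%:~R = 0 -> k = 0 /\ l = 0.
  move=> E; have H := wind (fun i => if i == ord0 then k else l) _.
  have {}H : forall i : 'I_2, (if i == ord0 then k else l) = 0.
    apply: H; apply: f_inj.
    by rewrite big_ord_recl big_ord1 /= raddfD !fz raddf0.
  by split; [exact: (H ord0) | exact: (H (lift ord0 ord0))].
have [yN|y0] := eqVneq y 0.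
  by case: (E0 0 1); rewrite ?yN ?mulr0z ?mulr0 ?mul0r ?addr0.
(* Both products in this relation equal [numq x * numq y] up to sign. *)
have := E0 (numq y * denq x) (- (numq x * denq y)); case.
  by rewrite mulrNz !intrM !numqE; ring.
move=> /eqP; rewrite mulf_eq0 numq_eq0 (negPf y0) (negPf (denq_neq0 x)) //.
Qed.

End Diagrams.

(** * Heights and denominators *)

(* Every positive integer up to [e] and every earlier base divides
   [base_aux e], hence is coprime to [base e]. *)
Fixpoint base_aux e :=
  if e is e'.+1 then base_aux e' * (base_aux e').+1 * e'.+1 else 1.
Definition base e := (base_aux e).+1.

Lemma base_aux_gt0 e : 0 < base_aux e.
Proof. by elim: e => //= e IHe; rewrite !muln_gt0 IHe. Qed.

Lemma base_gt1 e : 1 < base e.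
Proof. by rewrite ltnS base_aux_gt0. Qed.

Lemma base_aux_dvd i j : i <= j -> base_aux i %| base_aux j.
Proof.
elim: j => [|j IHj]; first by rewrite leqn0 => /eqP->.
rewrite leq_eqVlt => /predU1P[-> //|/IHj/dvdn_trans]; apply.
by rewrite /= -mulnA dvdn_mulr.
Qed.

Lemma coprime_base_dvd e u : u %| base_aux e -> coprime (base e) u.
Proof. by move=> /coprime_dvdr; apply; apply: coprimeSn. Qed.

Lemma coprime_base_small e u : 0 < u <= e -> coprime (base e) u.
Proof.
case: u => // u /= ue; apply: coprime_base_dvd.
by apply: dvdn_trans (base_aux_dvd ue); rewrite /= dvdn_mull.
Qed.

Lemma coprime_base i j : i != j -> coprime (base i) (base j).
Proof.
wlog: i j / i < j => [H ij|ij _].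
  have [lt_ij|] := ltnP i j; first exact: H.
  rewrite leq_eqVlt eq_sym (negPf ij) /= => lt_ji.
  by rewrite coprime_sym; apply: H; rewrite // eq_sym.
rewrite coprime_sym; apply: coprime_base_dvd.
by apply: dvdn_trans (base_aux_dvd ij); rewrite /= dvdn_mulr // dvdn_mull.
Qed.

Definition base_prod (f : nat -> nat) n := \prod_(e < n) base e ^ f e.

(** Serves to replace finitely many stages, one for each [e < n], by a common later one. *)
Lemma uniform_bound (Q : nat -> nat -> Prop) :
  (forall e, exists s, Q e s) ->
  (forall e s s', s <= s' -> Q e s -> Q e s') ->
  forall n, exists2 s, n <= s & forall e, e < n -> Q e s.
Proof.
move=> Qex Qmon; elim=> [|n [s le_ns IHn]]; first by exists 0.
have [s' Qs'] := Qex n; exists (maxn s.+1 s').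
  by rewrite leq_max ltnS le_ns.
move=> e; rewrite ltnS leq_eqVlt => /predU1P[->|/IHn].
  by apply: Qmon Qs'; rewrite leq_maxr.
by apply: Qmon; rewrite leq_max leqnSn.
Qed.

Definition limit (V : nat -> nat -> nat -> bool) e k := exists s, V e k s.

Definition increasing (V : nat -> nat -> nat -> bool) :=
  forall e k s s', s <= s' -> V e k s -> V e k s'.

(* The exponent of [base e] at stage [s] counts the [k < s] with [V e k s]; the
   group of fractions with denominators [denom V s] then has, at [base e],
   height the number of [k] with [limit V e k]. *)
Definition exponent (V : nat -> nat -> nat -> bool) e s := \sum_(k < s) V e k s.
Definition denom V s := base_prod (exponent V ^~ s) s.

Lemma denom_gt0 V s : 0 < denom V s.
Proof. by apply: prodn_gt0 => e; rewrite expn_gt0. Qed.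

Lemma sum_ltn n K : \sum_(k < n) (k < K) = minn n K.
Proof.
elim: n => [|n IHn]; first by rewrite big_ord0 min0n.
by rewrite big_ord_recr /= IHn; case: (ltnP n K); lia.
Qed.

Lemma sum_ord_widen (F F' : nat -> nat) m n :
  m <= n -> (forall k, k < m -> F k <= F' k) ->
  \sum_(k < m) F k <= \sum_(k < n) F' k.
Proof.
move=> le_mn FF'; apply: (@leq_trans (\sum_(k < m) F' k)).
  by apply: leq_sum => k _; exact: FF'.
by rewrite -!(big_mkord predT) (big_cat_nat _ le_mn) //= leq_addr.
Qed.

Lemma exponent_leq V e s s' :
  increasing V -> s <= s' -> exponent V e s <= exponent V e s'.
Proof.
move=> Vinc le_ss'.
apply: (sum_ord_widen (F := fun k => V e k s) (F' := fun k => V e k s')) => // k _.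
by have := Vinc e k _ _ le_ss'; case: (V e k s) => [->|].
Qed.

Lemma base_prod_dvd f f' m n :
  m <= n -> (forall e, e < m -> f e <= f' e) -> base_prod f m %| base_prod f' n.
Proof.
move=> le_mn ff'; apply: (@dvdn_trans (base_prod f' m)); last first.
  rewrite /base_prod -!(big_mkord predT (fun e => base e ^ f' e)).
  by rewrite (big_cat_nat _ le_mn) //= dvdn_mulr.
rewrite /base_prod; elim/big_ind2: _ => // [a b c d|e _]; first exact: dvdn_mul.
by rewrite dvdn_exp2l ?ff'.
Qed.

Lemma base_prodM f g n :
  base_prod f n * base_prod g n = base_prod (fun e => f e + g e) n.
Proof. by rewrite -big_split; apply: eq_bigr => e _; rewrite expnD. Qed.

Lemma denom_dvd V s s' : increasing V -> s <= s' -> denom V s %| denom V s'.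
Proof.
by move=> Vinc le_ss'; apply: base_prod_dvd => // e _; exact: exponent_leq.
Qed.

Lemma base_exp_dvd_denom V e K : increasing V ->
  (forall k, k < K -> limit V e k) ->
  exists s, forall s', s <= s' -> base e ^ K %| denom V s'.
Proof.
move=> Vinc lim.
have [||s le_s Vs] := @uniform_bound (fun k s => k < K -> V e k s) _ _ K.
- move=> k; have [/lim[s Vs]|] := ltnP k K; [by exists s | by exists 0].
- by move=> k s s' le_ss' Vs /Vs; exact: Vinc.
(* [base e] occurs among the factors of [denom V s'] only for [s' > e]. *)
exists (maxn s e.+1) => s'; rewrite geq_max => /andP[le_ss' lt_es'].
rewrite /denom /base_prod (bigD1 (Ordinal lt_es')) //= dvdn_mulr // dvdn_exp2l //.
have {1}-> : K = \sum_(k < K) (k < K) by rewrite sum_ltn minnn.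
apply: (sum_ord_widen (F := fun k => k < K) (F' := fun k => V e k s')).
  exact: leq_trans le_ss'.
by move=> k lt_kK; rewrite (Vinc _ _ _ _ le_ss' (Vs _ lt_kK lt_kK)) leq_b1.
Qed.

(** The factors of the denominator at other bases are coprime to [base e], so only the exponent at
    [e] counts, and it is at most [K]. *)
Lemma base_exp_dvd_denom_leq V e K m s :
  (forall k, limit V e k -> k < K) -> base e ^ m %| denom V s -> m <= K.
Proof.
move=> lim; have coq (P : pred 'I_s) : (forall i, P i -> i != e :> nat) ->
    coprime (base e ^ m) (\prod_(i < s | P i) base i ^ exponent V i s).
  move=> Pe; elim/big_ind: _ => [|a b ca cb|i Pi]; first exact: coprimen1.
    by rewrite coprimeMr ca.
  by rewrite coprimeXl // coprimeXr // coprime_base // eq_sym Pe.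
have [lt_es|le_se] := ltnP e s; last first.
  rewrite -[denom V s]muln1 Gauss_dvdr; last first.
    by apply: coq => i _; rewrite neq_ltn (leq_trans (ltn_ord i)).
  by rewrite dvdn1 -(expn0 (base e)) (eqn_exp2l _ _ (base_gt1 e)) => /eqP->.
rewrite /denom /base_prod (bigD1 (Ordinal lt_es)) //= Gauss_dvdl; last first.
  by apply: coq => i; rewrite -val_eqE.
rewrite dvdn_Pexp2l ?base_gt1 // => /leq_trans; apply.
apply: (@leq_trans (\sum_(k < s) (k < K))); last by rewrite sum_ltn geq_minr.
apply: (sum_ord_widen (F := fun k => V e k s) (F' := fun k => k < K)) => // k _.
by case Vk: (V e k s); rewrite // lim //; exists s.
Qed.

Definition decide (P : Prop) : bool :=
  if excluded_middle_informative P then true else false.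

Lemma decideP (P : Prop) : reflect P (decide P).
Proof. by rewrite /decide; case: excluded_middle_informative => h; constructor. Qed.

(* The amount by which the height at [base e] for [V'] exceeds the one for [V],
   when this is positive. *)
Definition defect V V' (k0 : nat -> nat) e : nat :=
  decide (limit V' e (k0 e)) && ~~ decide (limit V e (k0 e)).

Section AlmostEqual.
Variables (V V' : nat -> nat -> nat -> bool) (k0 : nat -> nat) (n : nat).
Hypotheses (V'inc : increasing V').
Hypothesis VV' : forall e k, k != k0 e -> limit V e k <-> limit V' e k.
Hypothesis VV'n : forall e k, n <= e -> limit V e k <-> limit V' e k.

(** Wait until [V'] has confirmed all [k < L] in its limit. The two sums then compare term by term
    except at [k0 e], where the defects absorb the difference. Heights may be infinite, so they
    cannot simply be subtracted. *)
Lemma exponent_defect e s : exists s',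
  defect V V' k0 e + exponent V e s <= defect V' V k0 e + exponent V' e s'.
Proof.
set L := maxn s (k0 e).+1.
have [||s' le_s Vs] := @uniform_bound (fun k s => limit V' e k -> V' e k s) _ _ L.
- move=> k; case: (decideP (limit V' e k)) => [[t Vt]|no]; first by exists t.
  by exists 0.
- by move=> k t t' le_tt' Vt /Vt; exact: V'inc.
exists s'.
have lt_k0 : k0 e < L by rewrite leq_max leqnn orbT.
apply: (@leq_trans (defect V V' k0 e + \sum_(k < L) V e k s)).
  rewrite leq_add2l.
  apply: (sum_ord_widen (F := fun k => V e k s) (F' := fun k => V e k s)) => //.
  exact: leq_maxl.
apply: (@leq_trans (defect V' V k0 e + \sum_(k < L) V' e k s')); last first.
  rewrite leq_add2l.
  by apply: (sum_ord_widen (F := fun k => V' e k s') (F' := fun k => V' e k s')).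
have split (F : nat -> nat) : \sum_(k < L) F k =
    F (k0 e) + \sum_(k < L | k != k0 e :> nat) F k.
  by rewrite (bigD1 (Ordinal lt_k0)).
rewrite (split (fun k => V e k s)) (split (fun k => V' e k s')).
rewrite !addnA leq_add //; last first.
  apply: leq_sum => k kk0.
  case Vk: (V e k s) => //; rewrite Vs //.
  by apply/VV' => //; exists s.
rewrite /defect; case: decideP => lim' /=.
  rewrite (Vs _ lt_k0 lim'); case: decideP => lim //=.
    by rewrite leq_b1.
  by case Vk: (V e _ s) => //; case: lim; exists s.
case: decideP => lim /=; first by case: (V e _ s).
by case Vk: (V e _ s) => //; case: lim; exists s.
Qed.

(** From [n] on the defects vanish, so finitely many correction factors suffice to make one
    divisibility chain dominate the other. *)
Lemma denom_defect s : exists s',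
  base_prod (defect V V' k0) n * denom V s %|
  base_prod (defect V' V k0) n * denom V' s'.
Proof.
have [|s' le_s' Es'] := uniform_bound (exponent_defect^~ s) _ (maxn n s).
  move=> e t t' le_tt' /leq_trans; apply.
  by rewrite leq_add2l exponent_leq.
set L := maxn n s in le_s' Es'.
exists s'; apply: (@dvdn_trans (base_prod (fun e =>
  defect V V' k0 e + exponent V e s) L)).
  by rewrite -base_prodM dvdn_mul // base_prod_dvd ?leq_maxl ?leq_maxr.
apply: dvdn_trans (base_prod_dvd (leqnn L) Es') _.
rewrite -base_prodM dvdn_mul //; last exact: base_prod_dvd.
rewrite /base_prod -!(big_mkord predT (fun e => base e ^ defect V' V k0 e)).
rewrite (@big_cat_nat _ _ _ n 0 L) ?leq_maxl //= [X in _ * X]big1_seq ?muln1 //.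
move=> e; rewrite mem_index_iota => /andP[_ /andP[le_ne _]].
have -> : defect V' V k0 e = 0; last by [].
rewrite /defect.
have -> : decide (limit V e (k0 e)) = decide (limit V' e (k0 e)).
  by apply/decideP/decideP => /VV'n; apply.
by rewrite andbN.
Qed.

End AlmostEqual.

(** * Groups of fractions *)

Definition frac (d : nat -> nat) s (z : int) : rat := (z%:~R / (d s)%:R)%R.

(** [v] identifies the group with the union of the subgroups [(1 / d s) Z] of the rationals. *)
Definition fraction_group (d : nat -> nat) (M : GRing.Zmodule nat)
    (v : nat -> rat) :=
  [/\ injective v, forall a b, v (gadd M a b) = (v a + v b)%R,
      forall a, exists s z, v a = frac d s z
    & forall s z, exists a, v a = frac d s z].

Section FractionGroups.
Local Open Scope ring_scope.

(** The equation [n (y / d s) = z / d r] amounts to [y n (d r) = z (d s)], which reduces division in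
    the group to divisibility of natural numbers. *)
Lemma fraction_group_divisible d M v (a : group_of M) n r z :
  (forall s, (0 < d s)%N) -> fraction_group d M v -> (0 < n)%N ->
  v a = frac d r z ->
  (exists c, c *+ n = a) <-> exists s, (n * d r %| `|z|%N * d s)%N.
Proof.
move=> d_gt0 [v_inj vD v_frac frac_v] n_gt0 Ea.
have dN0 s : (d s)%:R != 0 :> rat by rewrite pnatr_eq0 -lt0n.
have [f Ef] := @additive_of_fun (group_of M) rat v vD.
have vMn (c : group_of M) : v (c *+ n) = v c * n%:R.
  by rewrite -!Ef raddfMn mulr_natr.
have E s y : (frac d s y * n%:R = frac d r z) <->
    (y * (n * d r)%N%:Z = z * (d s)%:Z).
  rewrite /frac mulrAC; split=> [/eqP|E].
    rewrite eqr_div // => /eqP E; apply/eqP.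
    by rewrite -(eqr_int rat) !intrM PoszM intrM !mulrA; apply/eqP.
  apply/eqP; rewrite eqr_div //; apply/eqP.
  by move/(congr1 (fun i : int => i%:~R : rat)): E; rewrite PoszM !intrM !mulrA.
split=> [[c Ec]|[s /dvdnP[y Ey]]].
  have [s [y Es]] := v_frac c; exists s.
  move: Ea; rewrite -Ec vMn Es => /E Ez.
  by move/(congr1 absz): Ez; rewrite !abszM !absz_nat => <-; apply: dvdn_mull.
(* The quotient [y] comes from absolute values, so the sign of [z] is put back. *)
have [c Ec] := frac_v s (Num.sg z * y%:Z); exists c; apply: v_inj.
rewrite vMn Ec Ea; apply/(proj2 (E s _)).
by rewrite -mulrA -PoszM -Ey PoszM mulrA abszE -numEsg.
Qed.

Lemma fraction_group_neq0 d M v (a : group_of M) :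
  fraction_group d M v -> (a != 0) = (v a != 0).
Proof.
move=> [v_inj vD _ _]; have [f Ef] := @additive_of_fun (group_of M) rat v vD.
have f0 : v (@GRing.zero (group_of M)) = 0 by rewrite -Ef raddf0.
by rewrite -f0 (@inj_eq (group_of M) rat v v_inj).
Qed.

Lemma denom0 V : denom V 0 = 1%N.
Proof. by rewrite /denom /base_prod big_ord0. Qed.

(** The integers [u] and [w] are taken as elements: multiplying by the base wherever a group has the
    smaller height makes the heights of [u] and [w] agree at every base. The two corrected
    divisibility chains then dominate each other. *)
Lemma almost_equal_same_type V V' M M' v v' n :
  increasing V -> increasing V' ->
  fraction_group (denom V) M v -> fraction_group (denom V') M' v' ->
  (forall e, exists k0, forall k, k != k0 -> limit V e k <-> limit V' e k) ->
  (forall e k, (n <= e)%N -> limit V e k <-> limit V' e k) ->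
  exists (a : group_of M) (b : group_of M'),
    [/\ a != 0, b != 0 & same_divisors a b].
Proof.
move=> Vinc V'inc GM GM'.
move=> /(fun H e => constructive_indefinite_description _ (H e)) H.
pose k0 e := sval (H e); have VV' e : forall k, k != k0 e -> _ := svalP (H e).
move=> VV'n; pose u := base_prod (defect V V' k0) n.
pose w := base_prod (defect V' V k0) n.
have base_gt0 f : (0 < base_prod f n)%N.
  by apply: prodn_gt0 => e; rewrite expn_gt0.
have [_ _ _ /(_ 0%N u%:Z)[a Ea]] := GM; have [_ _ _ /(_ 0%N w%:Z)[b Eb]] := GM'.
exists a, b; split.
- rewrite (fraction_group_neq0 _ GM) Ea /frac denom0 divr1 -pmulrn pnatr_eq0.
  by rewrite -lt0n; exact: base_gt0.
- rewrite (fraction_group_neq0 _ GM') Eb /frac denom0 divr1 -pmulrn pnatr_eq0.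
  by rewrite -lt0n; exact: base_gt0.
move=> m m_gt0.
rewrite (fraction_group_divisible (denom_gt0 V) GM m_gt0 Ea).
rewrite (fraction_group_divisible (denom_gt0 V') GM' m_gt0 Eb).
rewrite !denom0 muln1 !absz_nat; split=> -[s /dvdn_trans dvd].
  have [s' /dvd] := denom_defect V'inc VV' VV'n s; by exists s'.
have [||s' /dvd] := @denom_defect V' V k0 n Vinc _ _ s; last by exists s'.
  by move=> e k /VV' [? ?].
by move=> e k /VV'n -/(_ k)[? ?].
Qed.

(** For large [e], [base e] is coprime to the numerator of [a] and to the denominator of [b]. So
    [base e ^ K.+1] divides [b], but cannot divide [a], whose height there is at most [K]. *)
Lemma distinct_types V V' M M' v v' :
  increasing V -> increasing V' ->
  fraction_group (denom V) M v -> fraction_group (denom V') M' v' ->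
  (forall n, exists e K, [/\ (n <= e)%N, forall k, limit V e k -> (k < K)%N
    & forall k, (k < K.+1)%N -> limit V' e k]) ->
  ~ exists (a : group_of M) (b : group_of M'),
    [/\ a != 0, b != 0 & same_divisors a b].
Proof.
move=> Vinc V'inc GM GM' H [a [b [aN0 bN0 ab]]].
have [_ _ /(_ a)[r [z Ea]] _] := GM; have [_ _ /(_ b)[r' [z' Eb]] _] := GM'.
have zN0 : (0 < `|z|)%N.
  move: aN0; rewrite (fraction_group_neq0 _ GM) Ea absz_gt0.
  by apply: contraNneq => ->; rewrite /frac mul0r.
have [e [K [le_e VK V'K]]] := H (maxn `|z|%N (denom V' r')).
move: le_e; rewrite geq_max => /andP[le_ze le_de].
have n_gt0 : (0 < base e ^ K.+1)%N by rewrite expn_gt0.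
have [s Hs] := base_exp_dvd_denom V'inc V'K.
have : exists d, d *+ (base e ^ K.+1) = b.
  apply/(fraction_group_divisible (denom_gt0 V') GM' n_gt0 Eb).
  (* Stage [s] provides the power of [base e] and stage [r'] the denominator of [b]; being coprime,
     they divide jointly. *)
  exists (maxn s r'); rewrite dvdn_mull // Gauss_dvd.
    by rewrite Hs ?leq_maxl // denom_dvd ?leq_maxr.
  by rewrite coprimeXl // coprime_base_small // denom_gt0.
move/(ab _ n_gt0)/(fraction_group_divisible (denom_gt0 V) GM n_gt0 Ea) => [t].
move/(dvdn_trans (dvdn_mulr _ (dvdnn _))).
rewrite Gauss_dvdr; last by rewrite coprimeXl // coprime_base_small ?zN0.
by move/(base_exp_dvd_denom_leq VK); rewrite ltnn.
Qed.

End FractionGroups.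

(** * Increasing enumeration of an infinite set *)

Section Enumeration.
Variable p : pred nat.
Hypothesis p_inf : forall u, exists u', (u < u') && p u'.

Definition next u := ex_minn (p_inf u).
Definition enumerate a := iter a next 0.

Lemma enumerate_lt a : enumerate a < enumerate a.+1.
Proof. by rewrite /= /next; case: ex_minnP => u /andP[]. Qed.

Lemma enumerate_ltn a b : a < b -> enumerate a < enumerate b.
Proof.
elim: b => // b IHb.
rewrite ltnS leq_eqVlt => /predU1P[->|/IHb/ltn_trans]; last apply.
  exact: enumerate_lt.
exact: enumerate_lt.
Qed.

Lemma enumerate_inj : injective enumerate.
Proof.
move=> a b Eab; case: (ltngtP a b) => // /enumerate_ltn; by rewrite Eab ltnn.
Qed.

Lemma enumerateP a : p 0 -> p (enumerate a).
Proof. by case: a => //= a _; rewrite /next; case: ex_minnP => u /andP[]. Qed.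

(** The enumeration eventually exceeds [u]; the entry just before it first does so is [u], since
    [next] skips no element of [p]. *)
Lemma enumerate_surj u : p u -> exists a, enumerate a = u.
Proof.
move=> pu.
have le_id a : a <= enumerate a.
  by elim: a => // a /leq_ltn_trans; apply; exact: enumerate_lt.
have [a lt_ua min_a] :=
  ex_minnP (ex_intro (fun a => u < enumerate a) _ (le_id u.+1)).
case: a lt_ua min_a => // a lt_ua min_a; exists a; apply/eqP; rewrite eqn_leq.
apply/andP; split.
  by rewrite leqNgt; apply/negP => /min_a; rewrite ltnn.
move: lt_ua; rewrite /= {1}/next; case: ex_minnP => w _ min_w lt_uw.
rewrite leqNgt; apply/negP => lt_au; have := min_w u; rewrite lt_au pu => /(_ isT).
by rewrite leqNgt lt_uw.
Qed.

End Enumeration.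

Lemma computable_enumerate (I : Type) (X : I -> real) (p : I -> nat -> pred nat)
    (p_inf : forall i w u, exists u', (u < u') && p i w u') :
  computable X (fun i u => nat_of_bool (p i (p1 u) (p2 u))) ->
  computable X (fun i u => enumerate (p_inf i (p1 u)) (p2 u)).
Proof.
move=> hp.
have hnext : computable X (fun i u => next (p_inf i (p1 u)) (p2 u)).
  apply: (@computable_mu _ _ _ (fun i u k => (p2 u < k) && p i (p1 u) k)).
  - apply: computable_negb; apply: computable_and; first by computable_tac.
    apply: (computable_ext (f := fun i u => nat_of_bool
      (p i (p1 (npair (p1 (p1 u)) (p2 u))) (p2 (npair (p1 (p1 u)) (p2 u)))))).
      by move=> i u; rewrite of_npair.
    apply: (computable_comp hp (g := fun _ u => npair (p1 (p1 u)) (p2 u))).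
    by computable_tac.
  - by move=> i u; rewrite /next; case: ex_minnP.
  - by move=> i u k; rewrite /next; case: ex_minnP => m _; exact.
apply: (computable_ext (f := fun i u => nat_rec (fun _ => nat) 0
    (fun _ w => next (p_inf i (p1 u)) w) (p2 u))).
  by move=> i u; elim: (p2 u) => //= n ->.
apply: (@computable_rec _ _ _ _ (fun i u _ w => next (p_inf i (p1 u)) w)).
- by computable_tac.
- by computable_tac.
apply: (computable_ext (f := fun i u =>
  next (p_inf i (p1 (npair (p1 (p1 u)) (p2 (p2 u)))))
       (p2 (npair (p1 (p1 u)) (p2 (p2 u)))))).
  by move=> i u; rewrite of_npair.
apply: (computable_comp hnext (g := fun _ u => npair (p1 (p1 u)) (p2 (p2 u)))).
by computable_tac.
Qed.

(** * Heights coding the equivalence relation *)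

(** Finite sets are coded in binary, [j] being a member when bit [j] of [S] is set; the numbers
    below [2 ^ n] code all subsets of the numbers below [n]. *)
Definition code_mem S j := odd (iter j half S).

Lemma code_mem_of_pred (C : pred nat) n :
  exists2 S, S < 2 ^ n & forall j, code_mem S j = (j < n) && C j.
Proof.
elim: n C => [|n IHn] C.
  exists 0 => // j; rewrite /code_mem; suff -> : iter j half 0 = 0 by [].
  by elim: j => //= j ->.
have [S lt_S HS] := IHn (C \o succn); exists (C 0 + S.*2).
  by rewrite expnS mul2n; case: (C 0); lia.
move=> [|j]; rewrite /code_mem.
  by rewrite /= oddD odd_double addbF; case: (C 0).
by rewrite iterSr half_bit_double ltnS; exact: HS.
Qed.

Section Heights.
Variable R : nat -> nat -> nat -> nat -> nat -> bool.

(* An edge [<i, <j, x>>] is the claim that [x] witnesses that [i] and [j] are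
   equivalent; [witnessed e t s]: by stage [s] it looks right up to [t]. *)
Definition witnessed e t s :=
  ball t (fun y => bex s (fun z => R (p1 e) (p1 (p2 e)) (p2 (p2 e)) y z)).

Definition closed e t s S :=
  ball e (fun e' => witnessed e' t s && code_mem S (p1 e') ==>
                    code_mem S (p1 (p2 e'))).

(* [j] can be reached from [p1 (p2 e)] along edges below [e]; quantifying over
   the closed sets avoids coding paths. *)
Definition reach e t s j :=
  ball (2 ^ e.+1) (fun S =>
    code_mem S (p1 (p2 e)) && closed e t s S ==> code_mem S j).

(* For [e = <m, <n, x>>], let [h] be the least [t] for which [m] is not
   reachable from [n], or infinity. The height at [base e] of the [j]-th group is [h] or
   [h + 1], the latter when [j] is reachable for [t = h] (so also for [j = n]). *)
Definition height_test j e k s :=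
  ((k == 0) || reach e k.-1 s (p1 e)) && (reach e k s (p1 e) || reach e k s j).

Lemma witnessed_mon e t t' s s' :
  t' <= t -> s <= s' -> witnessed e t s -> witnessed e t' s'.
Proof.
move=> le_t le_s /ballP H; apply/ballP => y lt_yt.
have /bexP[z lt_zs Rz] := H y (leq_trans lt_yt le_t).
by apply/bexP; exists z; rewrite ?(leq_trans lt_zs).
Qed.

Lemma reach_mon e t t' s s' j :
  t' <= t -> s <= s' -> reach e t s j -> reach e t' s' j.
Proof.
move=> le_t le_s /ballP H; apply/ballP => S /H /implyP HS.
apply/implyP => /andP[Sn /ballP cl]; apply: HS; rewrite Sn /=.
apply/ballP => e' /cl /implyP cl'; apply/implyP => /andP[w Se']; apply: cl'.
by rewrite Se' (witnessed_mon le_t le_s w).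
Qed.

Lemma height_test_increasing j : increasing (height_test j).
Proof.
move=> e k s s' le_s /andP[r1 r2]; apply/andP; split.
  by case/orP: r1 => [->|/(reach_mon (leqnn _) le_s) ->] //; rewrite orbT.
by case/orP: r2 => /(reach_mon (leqnn _) le_s) ->; rewrite ?orbT.
Qed.

Definition related i j := exists x, forall y, exists z, R i j x y z.

Definition reachable e t j := exists s, reach e t s j.

Lemma reachable_mon e t t' j : t' <= t -> reachable e t j -> reachable e t' j.
Proof. by move=> le_t [s /(reach_mon le_t (leqnn s)) r]; exists s. Qed.

Lemma reachable_refl e t : reachable e t (p1 (p2 e)).
Proof. by exists 0; apply/ballP => S _; apply/implyP => /andP[]. Qed.

Lemma limit_height_test j e k : limit (height_test j) e k <->
  (k = 0 \/ reachable e k.-1 (p1 e)) /\ (reachable e k (p1 e) \/ reachable e k j).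
Proof.
split=> [[s /andP[/orP r1 /orP r2]]|[r1 r2]].
  split; first by case: r1 => [/eqP->|r]; [left | right; exists s].
  by case: r2 => r; [left | right]; exists s.
have [s1 H1] : exists s, forall s', s <= s' ->
    (k == 0) || reach e k.-1 s' (p1 e).
  case: r1 => [->|[s r]]; first by exists 0.
  by exists s => s' le_s; rewrite (reach_mon (leqnn _) le_s r) orbT.
have [s2 H2] : exists s, forall s', s <= s' ->
    reach e k s' (p1 e) || reach e k s' j.
  by case: r2 => -[s r]; exists s => s' le_s;
    rewrite (reach_mon (leqnn _) le_s r) ?orbT.
by exists (maxn s1 s2); rewrite /height_test H1 ?leq_maxl // H2 ?leq_maxr.
Qed.

(** A true witness [x] gives an edge [<i, <j, x>>] that looks right up to every bound; once [e]
    exceeds its code, every closed set containing [i] must contain [j]. *)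
Lemma related_reachable i j : related i j ->
  exists n, forall e t, n <= e -> reachable e t i -> reachable e t j.
Proof.
move=> [x Hx]; exists (npair i (npair j x)).+1 => e t lt_e [s r].
have [||s' _ Hs'] := @uniform_bound (fun y s => bex s (R i j x y)) _ _ t.
- by move=> y; have [z Rz] := Hx y; exists z.+1; apply/bexP; exists z.
- move=> y u u' le_u /bexP[z lt_z Rz]; apply/bexP; exists z => //.
  exact: leq_trans le_u.
have w : witnessed (npair i (npair j x)) t (maxn s s').
  apply: (witnessed_mon (leqnn t) (leq_maxr s s')).
  by apply/ballP => y /Hs'; rewrite !of_npair /= ?of_npair.
exists (maxn s s'); apply/ballP => S lt_S; apply/implyP => /andP[Sn cl].
have Si : code_mem S i.
  have /ballP/(_ S lt_S)/implyP := reach_mon (leqnn t) (leq_maxl s s') r.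
  by apply; rewrite Sn.
by move/ballP/(_ _ lt_e): cl; rewrite w !of_npair /= ?of_npair Si.
Qed.

Hypothesis related_sym : forall i j, related i j -> related j i.
Hypothesis related_refl : forall i, related i i.
Hypothesis related_trans : forall i j k, related i j -> related j k -> related i k.

(** Each false edge below [e] is refuted at some bound, whatever the stage. For a [t] beyond these
    finitely many bounds only true edges survive, so the equivalence class of the starting point is
    closed, and it omits [j]. *)
Lemma unrelated_unreachable e j :
  ~ related (p1 (p2 e)) j -> exists t, ~ reachable e t j.
Proof.
move=> unrel.
have [||t _ Ht] := @uniform_bound (fun e' t => related (p1 e') (p1 (p2 e')) \/
    forall s, ~~ witnessed e' t s) _ _ e.
- move=> e'; have [|no] := classic (related (p1 e') (p1 (p2 e'))).
    by exists 0; left.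
  have [y noy] : exists y, forall z, ~~ R (p1 e') (p1 (p2 e')) (p2 (p2 e')) y z.
    apply: NNPP => H; apply: no; exists (p2 (p2 e')) => y; apply: NNPP => H'.
    by apply: H; exists y => z; apply/negP => Rz; apply: H'; exists z.
  exists y.+1; right=> s; apply/negP => /ballP/(_ y (leqnn _))/bexP[z _].
  by apply/negP.
- move=> e' t t' le_t [|H]; [by left | right=> s; apply: contra (H s)].
  exact: witnessed_mon.
exists t => -[s /ballP r].
(* The class is cut down to the numbers up to [e], which include the endpoints of all edges below
   [e]. *)
have [S lt_S HS] :=
  code_mem_of_pred (fun k => decide (related (p1 (p2 e)) k)) e.+1.
have le1 x : p1 x <= x by have := leq_npair (p1 x) (p2 x); rewrite npair_of; lia.
have le2 x : p2 x <= x by have := leq_npair (p1 x) (p2 x); rewrite npair_of; lia.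
have : code_mem S j; last by rewrite HS => /andP[_ /decideP].
apply: (implyP (r S lt_S)); apply/andP; split.
  rewrite HS ltnS (leq_trans (le1 _)) //=; exact/decideP.
apply/ballP => e' lt_e'; apply/implyP => /andP[w].
rewrite !HS => /andP[_ /decideP rel]; rewrite ltnS.
rewrite (leq_trans (le1 _)) ?(leq_trans (le2 _)) ?(ltnW lt_e') //=.
apply/decideP; apply: related_trans rel _.
by case: (Ht e' lt_e') => // /(_ s); rewrite w.
Qed.

Lemma first_unreachable e j : (exists t, ~ reachable e t j) ->
  exists K, forall k, reachable e k j <-> k < K.
Proof.
move=> [t no].
have ex : exists t, ~~ decide (reachable e t j) by exists t; apply/decideP.
have [K noK minK] := ex_minnP ex; exists K => k; split=> [r|lt_k].
  rewrite ltnNge; apply/negP => le_K; case/negP: noK; apply/decideP.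
  exact: reachable_mon r.
apply: NNPP => no'; have := minK k; rewrite leqNgt lt_k => H.
by have : false by apply: H; apply/decideP.
Qed.

(** For large [e], [i] and [j] are reachable for the same bounds. For every [e], the test depends on
    the group only at the first [k] where [p1 e] is unreachable, so there is at most one
    exception. *)
Lemma related_limits i j : related i j ->
  (exists n, forall e k, n <= e ->
     limit (height_test i) e k <-> limit (height_test j) e k) /\
  forall e, exists k0, forall k, k != k0 ->
     limit (height_test i) e k <-> limit (height_test j) e k.
Proof.
move=> rel; split.
  have [n Hn] := related_reachable rel.
  have [n' Hn'] := related_reachable (related_sym rel).
  exists (maxn n n') => e k; rewrite geq_max => /andP[/Hn{}Hn /Hn'{}Hn'].
  by split=> /limit_height_test[r1 r2]; apply/limit_height_test; split=> //;
    case: r2; auto.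
move=> e; have [/first_unreachable[K HK]|no] :=
  classic (exists t, ~ reachable e t (p1 e)).
  (* Below [K] reachability of [p1 e] settles both conjuncts; above [K] the first conjunct already
     fails. *)
  have E l k : k != K -> limit (height_test l) e k <-> k < K.
    move=> kK; split=> [/limit_height_test[[k0|/HK lt_k] _]|lt_k].
    - by lia.
    - by lia.
    apply/limit_height_test; split; last by left; apply/HK.
    by case: k kK lt_k => [|k] _ lt_k; [left | right; apply/HK; lia].
  by exists K => k kK; rewrite !E.
have all_r k : reachable e k (p1 e) by apply: NNPP => H; apply: no; exists k.
by exists 0 => k _; split=> _; apply/limit_height_test; auto.
Qed.

Lemma unrelated_limits m n : ~ related m n ->
  forall b, exists e K, [/\ b <= e,
    forall k, limit (height_test m) e k -> k < K
    & forall k, k < K.+1 -> limit (height_test n) e k].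
Proof.
(* The component [b] only serves to push [e] beyond the bound. *)
move=> unrel b; set e := npair m (npair n b).
have e1 : p1 e = m by rewrite of_npair.
have e2 : p1 (p2 e) = n by rewrite !of_npair /= ?of_npair.
have [|K HK] := @first_unreachable e m.
  by apply: unrelated_unreachable; rewrite e2 => /related_sym.
exists e, K; split.
- by have := leq_npair m (npair n b); have := leq_npair n b; rewrite -/e; lia.
- by move=> k /limit_height_test[_]; rewrite e1 => -[] /HK.
move=> k lt_k; apply/limit_height_test; rewrite e1; split.
  by case: k lt_k => [|k] lt_k; [left | right; apply/HK].
by right; rewrite -e2; exact: reachable_refl.
Qed.

End Heights.

(** * Atomic diagrams *)

(* The number [<s, <p, n>>] codes the fraction [(p - n) / d s]. *)
Definition numerator u : int := ((p1 (p2 u))%:Z - (p2 (p2 u))%:Z)%R.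
Definition value d u : rat := frac d (p1 u) (numerator u).

(** Equality of fractions, cross-multiplied and with the negative terms moved across, so that it is
    decided within the natural numbers; [sum_value] is built likewise. *)
Definition same_value (d : nat -> nat) u v :=
  p1 (p2 u) * d (p1 v) + p2 (p2 v) * d (p1 u) ==
  p1 (p2 v) * d (p1 u) + p2 (p2 u) * d (p1 v).

Definition sum_value (d : nat -> nat) u v w :=
  p1 (p2 u) * (d (p1 v) * d (p1 w)) + p1 (p2 v) * (d (p1 u) * d (p1 w)) +
    p2 (p2 w) * (d (p1 u) * d (p1 v)) ==
  p2 (p2 u) * (d (p1 v) * d (p1 w)) + p2 (p2 v) * (d (p1 u) * d (p1 w)) +
    p1 (p2 w) * (d (p1 u) * d (p1 v)).

(** Selects the least code of each fraction, so that elements correspond to codes one to one. *)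
Definition fresh d u := ball u (fun v => ~~ same_value d v u).

Definition diagram d (enum : nat -> nat) k :=
  if odd k
  then sum_value d (enum (p1 k./2)) (enum (p1 (p2 k./2))) (enum (p2 (p2 k./2)))
  else p1 k./2 == p2 k./2.

Section Presentation.
Variable d : nat -> nat.
Hypothesis d_gt0 : forall s, 0 < d s.
Local Open Scope ring_scope.

Lemma d_neq0 s : (d s)%:R != 0 :> rat.
Proof. by rewrite pnatr_eq0 -lt0n. Qed.

Lemma same_valueE u v : same_value d u v = (value d u == value d v).
Proof.
rewrite /value /numerator /frac eqr_div ?d_neq0 // /same_value -(eqr_nat rat).
rewrite !natrD !natrM !rmorphB /= -!pmulrn -subr_eq0 -[in RHS]subr_eq0.
by congr (_ == 0); ring.
Qed.

Lemma sum_valueE u v w :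
  sum_value d u v w = (value d u + value d v == value d w).
Proof.
rewrite /value /numerator /frac addf_div ?d_neq0 // eqr_div ?mulf_neq0 ?d_neq0 //.
rewrite /sum_value -(eqr_nat rat).
rewrite !natrD !natrM !rmorphB /= -!pmulrn -subr_eq0 -[in RHS]subr_eq0.
by congr (_ == 0); ring.
Qed.

Lemma value_npair s p n : value d (npair s (npair p n)) = frac d s (p%:Z - n%:Z).
Proof. by rewrite /value /numerator !of_npair /= ?of_npair. Qed.

Lemma fresh_representative u : exists v, fresh d v /\ value d v = value d u.
Proof.
have [v /eqP Ev minv] :=
  ex_minnP (ex_intro (fun v => value d v == value d u) u (eqxx _)).
exists v; split=> //; apply/ballP => w lt_w; rewrite same_valueE Ev.
by apply/negP => /minv; rewrite leqNgt lt_w.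
Qed.

Lemma fresh_inj u v : fresh d u -> fresh d v -> value d u = value d v -> u = v.
Proof.
move=> /ballP fu /ballP fv Euv; case: (ltngtP u v) => // [/fv|/fu];
  by rewrite same_valueE Euv eqxx.
Qed.

(** Pigeonhole: the [u + 2] fractions [i / d 0] cannot all be values of the [u + 1] codes up to [u],
    and the least code of a new one is fresh. *)
Lemma fresh_infinite u : exists v, (u < v)%N && fresh d v.
Proof.
pose f i := value d (npair 0 (npair i 0)).
pose vs := [seq value d w | w <- iota 0 u.+1].
have f_inj : injective f.
  move=> i j; rewrite /f !value_npair /frac !subr0 => /eqP.
  by rewrite (inj_eq (mulIf (invr_neq0 (d_neq0 0)))) -!pmulrn eqr_nat => /eqP.
have [i _ i_new] : exists2 i, i \in iota 0 u.+2 & f i \notin vs.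
  apply/hasP; rewrite has_predC; apply/negP => /allP sub.
  have : uniq (map f (iota 0 u.+2)) by rewrite map_inj_uniq ?iota_uniq.
  move=> /(@uniq_leq_size _ _ vs); rewrite !size_map !size_iota ltnn.
  move=> H; suff : false by [].
  by apply: H => q /mapP[i ii ->]; exact: sub.
have [v [fv Ev]] := fresh_representative (npair 0 (npair i 0)).
exists v; rewrite fv andbT ltnNge; apply: contra i_new => le_v.
by apply/mapP; exists v; rewrite // mem_iota.
Qed.

Hypothesis d_dvd : forall s s', (s <= s')%N -> (d s %| d s')%N.

Lemma frac_widen s s' z : (s <= s')%N -> exists z', frac d s z = frac d s' z'.
Proof.
move=> /d_dvd/dvdnP[k Ek]; exists (z * k%:Z); rewrite /frac; apply/eqP.
by rewrite eqr_div ?d_neq0 // Ek natrM intrM -pmulrn; apply/eqP; ring.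
Qed.

Definition enum_fresh := enumerate fresh_infinite.

Lemma enum_fresh_value u : exists a, value d (enum_fresh a) = value d u.
Proof.
have [v [fv Ev]] := fresh_representative u.
have [a Ea] := enumerate_surj fresh_infinite fv.
by exists a; rewrite /enum_fresh Ea.
Qed.

Lemma enum_fresh_frac s z : exists a, value d (enum_fresh a) = frac d s z.
Proof.
have [p [n ->]] : exists p n : nat, z = p%:Z - n%:Z.
  case: z => n; first by exists n, 0%N; rewrite subr0.
  by exists 0%N, n.+1; rewrite sub0r NegzE.
have [a Ea] := enum_fresh_value (npair s (npair p n)).
by exists a; rewrite Ea value_npair.
Qed.

Lemma diagram_fraction_group : exists M : GRing.Zmodule nat,
  diagram d enum_fresh =1 atomic_diagram M /\
  fraction_group d M (fun a => value d (enum_fresh a)).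
Proof.
pose v a := value d (enum_fresh a).
have v_inj : injective v.
  move=> a b Eab; apply: (@enumerate_inj _ fresh_infinite).
  by apply: fresh_inj Eab; apply: enumerateP; apply/ballP.
have [|||M vD] := @zmodule_of_injection v v_inj.
- have [a Ea] := enum_fresh_frac 0 0; exists a.
  by rewrite /v Ea /frac mul0r.
- move=> a b; rewrite /v /value.
  set s := p1 (enum_fresh a); set s' := p1 (enum_fresh b).
  (* Two fractions are added over the denominator of the later of their stages. *)
  have [z ->] := frac_widen (numerator (enum_fresh a)) (leq_maxl s s').
  have [z' ->] := frac_widen (numerator (enum_fresh b)) (leq_maxr s s').
  have [c Ec] := enum_fresh_frac (maxn s s') (z + z'); exists c.
  by move: Ec; rewrite /value => ->; rewrite /frac intrD mulrDl.
- move=> a; rewrite /v /value; set s := p1 _; set z : int := (X in frac d s X).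
  have [b Eb] := enum_fresh_frac s (- z); exists b.
  by move: Eb; rewrite /value => ->; rewrite /frac mulrNz mulNr.
exists M; split; last first.
  split=> // a; last exact: enum_fresh_frac.
  by exists (p1 (enum_fresh a)), (numerator (enum_fresh a)).
move=> k; rewrite /diagram /atomic_diagram /join; case: ifP => _.
  rewrite sum_valueE; case: (Cantor.of_nat k./2) => a l /=.
  case: (Cantor.of_nat l) => b c /=.
  rewrite -[value d (enum_fresh a) + _]vD.
  by apply/eqP/eqP => [/v_inj|->].
by case: (Cantor.of_nat k./2) => a b /=; apply/eqP/eqP.
Qed.

End Presentation.

(** * The complexity of isomorphism *)

Definition diagram_plus (G : real) a b c := G (npair a (npair b c)).*2.+1.

Definition code_nth l i := p1 (iter i (fun x => p2 x) l).

Lemma code_nth_of_fun (f : nat -> nat) n :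
  exists l, forall i, i <= n -> code_nth l i = f i.
Proof.
elim: n f => [|n IHn] f.
  exists (npair (f 0) 0) => i; rewrite leqn0 => /eqP->.
  by rewrite -[LHS]/(p1 (npair (f 0) 0)) of_npair.
have [l Hl] := IHn (f \o succn); exists (npair (f 0) l) => -[_|i lt_i].
  by rewrite /code_nth /= of_npair.
by rewrite /code_nth iterSr /= of_npair; exact: Hl.
Qed.

(* [l] lists the multiples [c, 2c, ..., (n + 1)c = a] of some [c]. *)
Definition multiples G l n a :=
  ball n (fun i => diagram_plus G (code_nth l i) (code_nth l 0) (code_nth l i.+1))
  && (code_nth l n == a).

Lemma multiplesP G (M : GRing.Zmodule nat) n (a : group_of M) :
  G =1 atomic_diagram M ->
  (exists l, multiples G l n a) <-> (exists c, c *+ n.+1 = a)%R.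
Proof.
move=> GM; split=> [[l /andP[/ballP Hl /eqP <-]]|[c <-]].
  exists (code_nth l 0 : group_of M).
  elim: n Hl => [|n IHn] Hl; first by rewrite mulr1n.
  rewrite mulrSr IHn => [|i lt_in]; last exact/Hl/ltnW.
  by have := Hl n (leqnn _); rewrite /diagram_plus (diagram_add _ _ _ GM) => /eqP.
have [l Hl] := code_nth_of_fun (fun i => (c *+ i.+1)%R) n; exists l.
apply/andP; split; last by rewrite Hl.
apply/ballP => i lt_in; rewrite /diagram_plus (diagram_add _ _ _ GM).
by rewrite !Hl ?(ltnW lt_in) // mulr1n -mulrSr.
Qed.

(** [x] codes the pair of elements, [y = <n, <l, l'>>] a divisor [n + 1] with candidate lists of
    multiples, and [z] the lists answering them. Divisibility is existential, so the implications
    between divisibilities take the form of a universal followed by an existential quantifier. *)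
Definition same_type_test (G H : real) x y z :=
  [&& ~~ diagram_plus G (p1 x) (p1 x) (p1 x),
      ~~ diagram_plus H (p2 x) (p2 x) (p2 x),
      multiples G (p1 (p2 y)) (p1 y) (p1 x) ==> multiples H (p1 z) (p1 y) (p2 x)
    & multiples H (p2 (p2 y)) (p1 y) (p2 x) ==> multiples G (p2 z) (p1 y) (p1 x)].

Lemma same_type_testP (G H : real) (M N : GRing.Zmodule nat)
    (a : group_of M) (b : group_of N) :
  G =1 atomic_diagram M -> H =1 atomic_diagram N ->
  (forall y, exists z, same_type_test G H (npair a b) y z) <->
  [/\ a != 0, b != 0 & same_divisors a b]%R.
Proof.
move=> GM HN; rewrite (diagram_neq0 a GM) (diagram_neq0 b HN).
rewrite /same_type_test of_npair /=; split=> [test|[aN0 bN0 ab] y].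
  split; first by have [z /andP[]] := test 0.
    by have [z /and3P[]] := test 0.
  case=> // n _; split.
    move=> /(multiplesP n a GM)[l Hl]; apply/(multiplesP n b HN).
    have [z] := test (npair n (npair l 0)); rewrite !of_npair /= ?of_npair /= Hl.
    by move=> /and4P[_ _ Hz _]; exists (p1 z).
  move=> /(multiplesP n b HN)[l Hl]; apply/(multiplesP n a GM).
  have [z] := test (npair n (npair 0 l)); rewrite !of_npair /= ?of_npair /= Hl.
  by move=> /and4P[_ _ _ Hz]; exists (p2 z).
rewrite /diagram_plus aN0 bN0 /=.
have Hab l : exists k, multiples G l (p1 y) a ==> multiples H k (p1 y) b.
  case Gl: (multiples G l (p1 y) a); last by exists 0.
  have /(multiplesP _ a GM) : exists l, multiples G l (p1 y) a by exists l.
  by move/(ab _ (ltn0Sn _))/(multiplesP _ b HN) => [k Hk]; exists k.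
have Hba l : exists k, multiples H l (p1 y) b ==> multiples G k (p1 y) a.
  case Hl: (multiples H l (p1 y) b); last by exists 0.
  have /(multiplesP _ b HN) : exists l, multiples H l (p1 y) b by exists l.
  by move/(ab _ (ltn0Sn _))/(multiplesP _ a GM) => [k Gk]; exists k.
have [k Hk] := Hab (p1 (p2 y)); have [k' Hk'] := Hba (p2 (p2 y)).
by exists (npair k k'); rewrite of_npair /= Hk.
Qed.

Lemma computable_code_nth (I : Type) (X : I -> real) f g :
  computable X f -> computable X g ->
  computable X (fun i u => code_nth (f i u) (g i u)).
Proof.
move=> hf hg; apply: computable_p1.
by apply: (@computable_iter _ _ _ _ (fun _ x => p2 x)) => //; computable_tac.
Qed.

Lemma computable_multiples (I : Type) (X Y : I -> real) f g h :
  computable X (fun i u => nat_of_bool (Y i u)) ->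
  computable X f -> computable X g -> computable X h ->
  computable X (fun i u => nat_of_bool (multiples (Y i) (f i u) (g i u) (h i u))).
Proof.
move=> hY hf hg hh; apply: computable_and; last first.
  by apply: computable_eq => //; exact: computable_code_nth.
apply: computable_ball => //.
have hl : computable X (fun i u => f i (p1 u)).
  by apply: (computable_comp hf); computable_tac.
apply: (computable_comp hY).
repeat (first [apply: computable_code_nth | computable_step]; cbv beta).
Qed.

Lemma computable_same_type_test : computable_predicate same_type_test.
Proof.
pose X (AB : real * real) := join AB.1 AB.2.
have hA : computable X (fun AB u => nat_of_bool (AB.1 u)).
  apply: (computable_ext (f := fun AB u => nat_of_bool (X AB u.*2))).
    by move=> AB u; rewrite /X /join odd_double doubleK.
  by apply: computable_oracle; computable_tac.
have hB : computable X (fun AB u => nat_of_bool (AB.2 u)).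
  apply: (computable_ext (f := fun AB u => nat_of_bool (X AB u.*2.+1))).
    by move=> AB u; rewrite /X /join /= odd_double uphalf_double.
  by apply: computable_oracle; computable_tac.
have hplus (Y : real * real -> real) f :
    computable X (fun AB u => nat_of_bool (Y AB u)) -> computable X f ->
    computable X (fun AB u =>
      nat_of_bool (diagram_plus (Y AB) (f AB u) (f AB u) (f AB u))).
  by move=> hY hf; apply: (computable_comp hY); computable_tac.
have [c hc] : computable X (fun AB u => nat_of_bool
    (same_type_test AB.1 AB.2 (p1 u) (p1 (p2 u)) (p2 (p2 u)))).
  rewrite /same_type_test; repeat (apply: computable_and; cbv beta).
  - by apply/computable_negb/hplus; computable_tac.
  - by apply/computable_negb/hplus; computable_tac.
  - by apply: computable_imp; apply: computable_multiples => //; computable_tac.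
  - by apply: computable_imp; apply: computable_multiples => //; computable_tac.
exists c => A B x y z; have := hc (A, B) (npair x (npair y z)).
by rewrite of_npair /= of_npair.
Qed.

Lemma Sigma03_isomorphic : Sigma03_on TFAb1 isomorphic.
Proof.
exists same_type_test; split; first exact: computable_same_type_test.
move=> G H [M [GM tfM rkM]] [N [HN tfN rkN]].
rewrite (isomorphicP GM HN tfM tfN rkM rkN); split=> [[a [b ab]]|[x Hx]].
  by exists (npair a b); apply/(same_type_testP a b GM HN).
exists (p1 x : group_of M), (p2 x : group_of N).
by apply/(same_type_testP _ _ GM HN); rewrite npair_of.
Qed.

(** * The reduction *)

Section Reduction.
Variables (I : Type) (X : I -> real).
Variable R : I -> nat -> nat -> nat -> nat -> nat -> bool.
Hypothesis computable_R : computable X (fun i u => nat_of_bool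
  (R i (p1 (p1 u)) (p2 (p1 u)) (p1 (p2 u)) (p1 (p2 (p2 u))) (p2 (p2 (p2 u))))).

Definition denominators i j := denom (height_test (R i) j).

Definition universe_enum i j :=
  enum_fresh (denom_gt0 (height_test (R i) j)).

Definition reduction i j := diagram (denominators i j) (universe_enum i j).

Lemma computable_relation m n x y z :
  computable X m -> computable X n -> computable X x -> computable X y ->
  computable X z ->
  computable X (fun i u =>
    nat_of_bool (R i (m i u) (n i u) (x i u) (y i u) (z i u))).
Proof.
move=> hm hn hx hy hz; apply: computable_ext (computable_comp computable_R
  (computable_npair (computable_npair hm hn)
     (computable_npair hx (computable_npair hy hz)))).
by move=> i u; rewrite !of_npair /= ?of_npair /= ?of_npair.
Qed.

(** Under a bounded quantifier, sum or product the input becomes [<u, k>]; this lets outer functions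
    still be applied to [u]. *)
Lemma computable_weaken f :
  computable X f -> computable X (fun i u => f i (p1 u)).
Proof. by move=> hf; apply: (computable_comp hf); computable_tac. Qed.

Lemma computable_witnessed e t s :
  computable X e -> computable X t -> computable X s ->
  computable X (fun i u => nat_of_bool (witnessed (R i) (e i u) (t i u) (s i u))).
Proof.
move=> he ht hs; have he2 := computable_weaken (computable_weaken he).
have hs1 := computable_weaken hs.
rewrite /witnessed.
repeat (first [apply: computable_relation | computable_step]; cbv beta).
Qed.

Lemma computable_code_mem S j : computable X S -> computable X j ->
  computable X (fun i u => nat_of_bool (code_mem (S i u) (j i u))).
Proof.
move=> hS hj; apply: computable_odd.
by apply: (@computable_iter _ _ _ _ (fun _ => half)) => //; computable_tac.
Qed.

Lemma computable_closed e t s S :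
  computable X e -> computable X t -> computable X s -> computable X S ->
  computable X (fun i u =>
    nat_of_bool (closed (R i) (e i u) (t i u) (s i u) (S i u))).
Proof.
move=> he ht hs hS.
have [ht1 hs1 hS1] := And3 (computable_weaken ht) (computable_weaken hs)
  (computable_weaken hS).
rewrite /closed.
repeat (first [apply: computable_witnessed
  | apply: computable_code_mem | computable_step]; cbv beta).
Qed.

Lemma computable_reach e t s j :
  computable X e -> computable X t -> computable X s -> computable X j ->
  computable X (fun i u =>
    nat_of_bool (reach (R i) (e i u) (t i u) (s i u) (j i u))).
Proof.
move=> he ht hs hj.
have [he1 ht1 [hs1 hj1]] := And3 (computable_weaken he) (computable_weaken ht)
  (conj (computable_weaken hs) (computable_weaken hj)).
rewrite /reach.
repeat (first [apply: computable_closed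
  | apply: computable_code_mem | computable_step]; cbv beta).
Qed.

Lemma computable_height_test j e k s :
  computable X j -> computable X e -> computable X k -> computable X s ->
  computable X (fun i u =>
    nat_of_bool (height_test (R i) (j i u) (e i u) (k i u) (s i u))).
Proof.
move=> hj he hk hs; rewrite /height_test.
repeat (first [apply: computable_reach | computable_step]; cbv beta).
Qed.

Lemma computable_base e : computable X e ->
  computable X (fun i u => base (e i u)).
Proof.
move=> he; apply: computable_succ.
apply: (computable_ext (f := fun i u => nat_rec (fun _ => nat) 1
   (fun m w => w * w.+1 * m.+1) (e i u))).
  by move=> i u; elim: (e i u) => //= m ->.
by apply: (@computable_rec _ _ _ _ (fun _ _ m w => w * w.+1 * m.+1));
  computable_tac.
Qed.

Lemma computable_denominators j s : computable X j -> computable X s ->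
  computable X (fun i u => denominators i (j i u) (s i u)).
Proof.
move=> hj hs.
have [hj2 hs1 hs2] := And3 (computable_weaken (computable_weaken hj))
  (computable_weaken hs) (computable_weaken (computable_weaken hs)).
apply: (computable_prod (h := fun i u e =>
  base e ^ exponent (height_test (R i) (j i u)) e (s i u))) => //.
apply: computable_exp; first by apply: computable_base; computable_tac.
apply: (computable_sum (h := fun i u k => nat_of_bool
  (height_test (R i) (j i (p1 u)) (p2 u) k (s i (p1 u))))) => //.
by apply: computable_height_test; computable_tac.
Qed.

Lemma computable_universe_enum j a : computable X j -> computable X a ->
  computable X (fun i u => universe_enum i (j i u) (a i u)).
Proof.
move=> hj ha.
have h : computable X (fun i u => universe_enum i (p1 u) (p2 u)).
  apply: (computable_enumerate (p := fun i w => fresh (denominators i w))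
    (fun i w => fresh_infinite (denom_gt0 (height_test (R i) w)))).
  rewrite /fresh /same_value.
  repeat (first [apply: computable_denominators | computable_step]; cbv beta).
apply: computable_ext (computable_comp h (computable_npair hj ha)).
by move=> i u; rewrite of_npair.
Qed.

Lemma computable_reduction :
  computable X (fun i u => nat_of_bool (reduction i (p1 u) (p2 u))).
Proof.
apply: (computable_ext (f := fun i u => if odd (p2 u) then
  nat_of_bool (sum_value (denominators i (p1 u))
    (universe_enum i (p1 u) (p1 (p2 u)./2))
    (universe_enum i (p1 u) (p1 (p2 (p2 u)./2)))
    (universe_enum i (p1 u) (p2 (p2 (p2 u)./2))))
  else nat_of_bool (p1 (p2 u)./2 == p2 (p2 u)./2))).
  by move=> i u; rewrite /reduction /diagram; case: odd.
rewrite /sum_value.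
repeat (first [apply: computable_universe_enum | apply: computable_denominators
  | computable_step]; cbv beta).
Qed.

End Reduction.

Lemma reduction_fraction_group (I : Type)
    (R : I -> nat -> nat -> nat -> nat -> nat -> bool) i j :
  exists M v, reduction R i j =1 atomic_diagram M /\
    fraction_group (denom (height_test (R i) j)) M v.
Proof.
have [s s'|M [HM GM]] := @diagram_fraction_group (denominators R i j)
  (denom_gt0 (height_test (R i) j)).
  by apply: denom_dvd; exact: height_test_increasing.
by eexists; eexists; split; [exact: HM | exact: GM].
Qed.

Lemma fraction_group_rank_one d M v :
  (forall s, 0 < d s) -> fraction_group d M v ->
  torsion_free (group_of M) /\ has_rank (group_of M) 1.
Proof.
move=> d_gt0 [v_inj vD _ frac_v]; apply: (embedded_rank_one v_inj vD).
have [a Ea] := frac_v 0 1%R; exists a; rewrite Ea /frac div1r invr_eq0.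
exact: d_neq0.
Qed.

Theorem theorem7p3 :
  Sigma03_on TFAb1 isomorphic /\
  forall (D : (nat -> bool) -> Prop)
         (E : (nat -> bool) -> (nat -> bool) -> Prop),
    equivalence_on D E ->
    Sigma03_on D E ->
    computably_countably_reducible D E TFAb1 isomorphic.
Proof.
split; first exact: Sigma03_isomorphic.
move=> D E [Erefl Esym Etrans] [P [[c0 hc0] EP]].
pose R (A : nat -> real) m n x y z := P (A m) (A n) x y z.
have [c1 hc1] := oracle_substitution c0.
have hR : computable bigjoin (fun A u => nat_of_bool
  (R A (p1 (p1 u)) (p2 (p1 u)) (p1 (p2 u)) (p1 (p2 (p2 u))) (p2 (p2 (p2 u))))).
  (* The input is unfolded as [<<m, n>, <x, <y, z>>>], the form that [oracle_substitution]
     expects. *)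
  exists c1 => A u; rewrite -{1}[u]npair_of -{1}[p1 u]npair_of; apply: hc1.
  by rewrite -{1}[p2 u]npair_of -{1}[p2 (p2 u)]npair_of; exact: hc0.
have [c hc] := computable_reduction hR.
(* The program was obtained before the sequence [A], hence is the same for all sequences. *)
exists c => A DA; exists (reduction R A).
have relE i j : related (R A) i j <-> E (A i) (A j) by split=> /EP; apply.
have sym i j : related (R A) i j -> related (R A) j i.
  by move=> /relE/Esym h; apply/relE/h.
have refl i : related (R A) i i by apply/relE/Erefl.
have trans i j k : related (R A) i j -> related (R A) j k -> related (R A) i k.
  by move=> /relE ij /relE jk; apply/relE; exact: Etrans ij jk.
split.
- move=> k; have := hc A k; rewrite /bigjoin; by case: (Cantor.of_nat k).
- move=> j; have [M [v [HM GM]]] := reduction_fraction_group R A j.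
  by exists M; have [] := fraction_group_rank_one (denom_gt0 _) GM.
move=> m n _.
have [M [v [HM GM]]] := reduction_fraction_group R A m.
have [N [w [HN GN]]] := reduction_fraction_group R A n.
have [tfM rkM] := fraction_group_rank_one (denom_gt0 _) GM.
have [tfN rkN] := fraction_group_rank_one (denom_gt0 _) GN.
(* By Baer's criterion it remains to compare divisors of nonzero elements in two groups of
   fractions. *)
rewrite (isomorphicP HM HN tfM tfN rkM rkN) -relE; split=> [rel|same].
  have [[b Hb] Hk] := related_limits sym rel.
  by apply: almost_equal_same_type GM GN Hk Hb; exact: height_test_increasing.
apply: NNPP => unrel; apply: distinct_types GM GN _ same.
- exact: height_test_increasing.
- exact: height_test_increasing.
exact: unrelated_limits.
Qed.
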